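(* There exist absolute constants $\bar\ell_1,\bar\ell_2>0$ such that the following holds. For any $\Delta,\ell,L_2,\mu,\epsilon>0$ with $\kappa_y=\ell/\mu\ge1$ and $$\epsilon\le\min\Big\{\frac14\Big(\frac{\ell}{\bar\ell_1}\Big)^{2}\Big(\frac{L_2}{\bar\ell_2}\Big)^{-1},\ \frac14\Delta^{7/10}\Big(\frac{\ell}{\bar\ell_1}\Big)^{-1/10}\Big(\frac{L_2}{\bar\ell_2}\Big)^{2/5}\Big\},$$ there exists a saddle point problem $\min_x\max_y f(x,y)$ such that: (i) $f$ is $\ell$-smooth and $\mu$-strongly concave in $y$; (ii) $\Phi(x):=\max_y f(x,y)$ has $L_2$-Lipschitz Hessian and $\Phi(0)-\min_x\Phi(x)\le\Delta$. Moreover, to find some $\bar x$ with $\|\nabla\Phi(\bar x)\|\le\epsilon$ for this problem, any first-order algorithm needs at least $\Omega\big(\Delta\sqrt{\kappa_y}\,\ell^{3/7}L_2^{2/7}\epsilon^{-12/7}\big)$ gradient evaluations.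
   Context: A first-order oracle, queried at $(x,y)$, returns $(f(x,y),\nabla_x f(x,y),\nabla_y f(x,y))$. A first-order algorithm starts from $(x_0,y_0)=(0,0)$ and its iterates satisfy $\operatorname{supp}(x_{t+1},y_{t+1})\subset\bigcup_{0\le i\le t}\big(\operatorname{supp}(x_i,y_i)\cup\operatorname{supp}(\nabla_x f(x_i,y_i),\nabla_y f(x_i,y_i))\big)$, where $\operatorname{supp}$ denotes the set of indices of nonzero coordinates. *)

(* Defs.v *)
From HB Require Import structures.
From mathcomp Require Import all_boot all_order all_algebra.
From mathcomp Require Import all_classical all_reals all_analysis.
From mathcomp Require Import Rstruct Rstruct_topology.
Set Implicit Arguments. Unset Strict Implicit. Unset Printing Implicit Defensive.
Import Order.TTheory GRing.Theory Num.Theory.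
Import numFieldNormedType.Exports.
Local Open Scope ring_scope.
Local Open Scope classical_set_scope.

Notation Rr := Rdefinitions.R.

Definition enorm {n : nat} (v : 'rV[Rr]_n) : Rr :=
  Num.sqrt (\sum_(i < n) (v ord0 i) ^+ 2).

Definition grad {n : nat} (g : 'rV[Rr]_n -> Rr) (x : 'rV[Rr]_n) : 'rV[Rr]_n :=
  \row_(i < n) derive (g : 'rV[Rr]_n -> Rr^o) x (delta_mx ord0 i).

Definition grad_x {d e : nat} (f : 'rV[Rr]_d -> 'rV[Rr]_e -> Rr) x y :=
  grad (fun x' => f x' y) x.
Definition grad_y {d e : nat} (f : 'rV[Rr]_d -> 'rV[Rr]_e -> Rr) x y :=
  grad (fun y' => f x y') y.

Definition smooth {d e : nat} (l : Rr) (f : 'rV[Rr]_d -> 'rV[Rr]_e -> Rr) :=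
  (forall z : 'rV[Rr]_d * 'rV[Rr]_e,
      differentiable (fun w : 'rV[Rr]_d * 'rV[Rr]_e => (f w.1 w.2 : Rr^o)) z) /\
  (forall x y x' y',
      enorm (grad_x f x y - grad_x f x' y') ^+ 2 +
      enorm (grad_y f x y - grad_y f x' y') ^+ 2
      <= l ^+ 2 * (enorm (x - x') ^+ 2 + enorm (y - y') ^+ 2)).

Definition strongly_concave_y {d e : nat} (mu : Rr)
    (f : 'rV[Rr]_d -> 'rV[Rr]_e -> Rr) :=
  forall x y y' (t : Rr), 0 <= t <= 1 ->
    t * f x y + (1 - t) * f x y' + mu / 2 * t * (1 - t) * enorm (y - y') ^+ 2
    <= f x (t *: y + (1 - t) *: y').

(* Phi(x) = max_y f(x,y) (written as a supremum; it is attained under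
   strong concavity and smoothness) *)
Definition Phi {d e : nat} (f : 'rV[Rr]_d -> 'rV[Rr]_e -> Rr) (x : 'rV[Rr]_d) : Rr :=
  sup (range (f x)).

(* g : R^n -> R is twice differentiable with L2-Lipschitz Hessian
   (operator norm induced by the Euclidean norm, unfolded) *)
Definition hessian_lipschitz {n : nat} (L2 : Rr) (g : 'rV[Rr]_n -> Rr) :=
  (forall x, differentiable (g : 'rV[Rr]_n -> Rr^o) x) /\
  (forall x, differentiable (grad g) x) /\
  (forall x x' v,
      enorm (derive (grad g) x v - derive (grad g) x' v)
      <= L2 * enorm (x - x') * enorm v).

(* zero-respecting (first-order) iterates (x_t, y_t) for the oracle of f:
   start at (0,0) and supp(x_{t+1},y_{t+1}) is contained in the union over
   i <= t of supp(x_i,y_i) and supp(grad_x f(x_i,y_i), grad_y f(x_i,y_i)). *)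
Definition first_order_iterates {d e : nat} (f : 'rV[Rr]_d -> 'rV[Rr]_e -> Rr)
    (xs : nat -> 'rV[Rr]_d) (ys : nat -> 'rV[Rr]_e) :=
  xs 0%N = 0 /\ ys 0%N = 0 /\
  forall t : nat,
    (forall j : 'I_d, xs t.+1 ord0 j != 0 ->
       exists2 i : nat, (i <= t)%N &
         xs i ord0 j != 0 \/ grad_x f (xs i) (ys i) ord0 j != 0) /\
    (forall j : 'I_e, ys t.+1 ord0 j != 0 ->
       exists2 i : nat, (i <= t)%N &
         ys i ord0 j != 0 \/ grad_y f (xs i) (ys i) ord0 j != 0).

(* Main.v *)
Require Import Defs.
From HB Require Import structures.
From mathcomp Require Import all_boot all_order all_algebra.
From mathcomp Require Import all_classical all_reals all_analysis.
From mathcomp Require Import Rstruct Rstruct_topology.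
From mathcomp Require Import ring lra.
Set Implicit Arguments. Unset Strict Implicit. Unset Printing Implicit Defensive.
Import Order.TTheory GRing.Theory Num.Theory.
Import numFieldNormedType.Exports.
Local Open Scope ring_scope.

(** The primal function is the hard function of Carmon, Duchi, Hinder and
Sidford,
  Psi(x) = lam [ a/2 (x_0 - s)^2 + 1/2 sum_(i < T) (x_i - x_(i+1))^2
                 + a^2 s^2 sum_(i < T) Ups (x_i / s) ],          x_T = 0,
whose gradient is at least a constant times lam s a^(3/2) as long as
x_(T-1) = 0.  To make every step along the chain cost about sqrt kappa
queries, each product x_i x_(i+1) is realised as a maximum over a path of m+1
fresh y-variables, coupled to x_i at one end and to x_(i+1) at the other: with
  q(y) = (y_0^2 + y_m^2) / m + sum_(k < m) (y_(k+1) - y_k)^2 >= |y|^2 / (4 m^2),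
the maximiser of the link is affine along the path, so that
f(x, y) = Psi(x) - lam/2 sum_i q(y^i - w(x_i, x_(i+1))) has no direct
interaction between x_i and x_(i+1).  Its variables, ordered along the path,
interact with their neighbours only, hence a first-order algorithm discovers at
most one of them per query.  When kappa is bounded the links are not needed and
the chain Psi itself is used.  The scales are a^(7/2) ~ L2 eps / lam^2,
s ~ lam a^2 / L2 and T ~ Delta / (lam s^2 a^2). *)

(** * The scalar nonlinearity *)

Section Well.
Variable R : realType.
Implicit Types x y : R.

Definition lor x : R := (1 + x ^+ 2)^-1.
Definition xlor x : R := x * lor x.
(* A rational-function variant of the nonlinearity of Carmon et al.; only the
   sign and the Lipschitz constants of its derivatives matter. *)
Definition Ups x : R := x ^+ 2 / 2 - x + xlor x + lor x / 2.
Definition dUps x : R := x - 1 + lor x ^+ 2 - xlor x ^+ 2 - lor x * xlor x.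
Definition ddUps x : R :=
  1 - 6 * lor x ^+ 2 * xlor x + 2 * xlor x ^+ 3 + 3 * lor x * xlor x ^+ 2
  - lor x ^+ 3.

Lemma lor_den_gt0 x : 0 < 1 + x ^+ 2.
Proof. by rewrite ltr_pwDl ?ltr01 ?sqr_ge0. Qed.

Lemma lor_gt0 x : 0 < lor x.
Proof. by rewrite invr_gt0 lor_den_gt0. Qed.

Lemma lor_le1 x : lor x <= 1.
Proof. by rewrite invf_le1 ?lor_den_gt0 // lerDl sqr_ge0. Qed.

Lemma xlor_ge x : - (1 / 2) <= xlor x.
Proof.
rewrite /xlor /lor ler_pdivlMr ?lor_den_gt0 //.
have := sqr_ge0 (x + 1); rewrite sqrrD; lra.
Qed.

Lemma xlor_le x : xlor x <= 1 / 2.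
Proof.
rewrite /xlor /lor ler_pdivrMr ?lor_den_gt0 //.
have := sqr_ge0 (x - 1); rewrite sqrrB; lra.
Qed.

(** [lor] and [xlor] are the real and imaginary parts of [1 / (1 - i x)]; this identity and [xlorB]
    are the two parts of its resolvent identity. *)
Lemma lorB x y : lor x - lor y = - (x - y) * (xlor x * lor y + lor x * xlor y).
Proof.
by rewrite /xlor /lor; field; rewrite !gt_eqF ?lor_den_gt0.
Qed.

Lemma xlorB x y : xlor x - xlor y = (x - y) * (lor x * lor y - xlor x * xlor y).
Proof.
by rewrite /xlor /lor; field; rewrite !gt_eqF ?lor_den_gt0.
Qed.

Lemma dUpsE x : dUps x = x ^+ 2 * (x ^+ 3 - x ^+ 2 + 2 * x - 3) / (1 + x ^+ 2) ^+ 2.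
Proof.
by rewrite /dUps /xlor /lor; field; rewrite !gt_eqF ?lor_den_gt0.
Qed.

Lemma dUps0 : dUps 0 = 0.
Proof. by rewrite dUpsE expr0n /= !mul0r. Qed.

Lemma dUps_le0 x : x <= 1 -> dUps x <= 0.
Proof.
move=> x1; rewrite dUpsE ler_pdivrMr ?exprn_gt0 ?lor_den_gt0 // mul0r.
rewrite mulr_ge0_le0 ?sqr_ge0 // -oppr_ge0.
have -> : - (x ^+ 3 - x ^+ 2 + 2 * x - 3) = 1 + (1 - x) * (x ^+ 2 + 2) by ring.
by rewrite addr_ge0 // mulr_ge0 ?subr_ge0 // addr_ge0 ?sqr_ge0.
Qed.

(** The interval around 0 is left out because [dUps] has a double zero there; elsewhere below 1 the
    forcing has a definite strength. *)
Lemma dUps_le x : x <= - (1 / 4) \/ 1 / 4 <= x <= 1 -> dUps x <= - (1 / 8).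
Proof.
move=> hx; rewrite dUpsE ler_pdivrMr ?exprn_gt0 ?lor_den_gt0 // -subr_ge0.
case: hx => [x4|/andP[x4 x1]].
  have -> : - (1 / 8) * (1 + x ^+ 2) ^+ 2 -
     x ^+ 2 * (x ^+ 3 - x ^+ 2 + 2 * x - 3) =
     (22 * x ^+ 2 + 7 * x ^+ 4 - 1) / 8 + (- x) * (2 * x ^+ 2 + x ^+ 4) by field.
  have h2 : 1 / 16 <= x ^+ 2 by nra.
  have h4 : 0 <= x ^+ 4 by rewrite exprn_even_ge0.
  by apply: addr_ge0; [lra | apply: mulr_ge0; lra].
have -> : - (1 / 8) * (1 + x ^+ 2) ^+ 2 -
     x ^+ 2 * (x ^+ 3 - x ^+ 2 + 2 * x - 3) =
   x ^+ 4 * (1 - x) + (x ^+ 2 * (16 * (1 - x) + (1 - x ^+ 2) + 5) - 1) / 8 by field.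
have h4 : 0 <= x ^+ 4 by rewrite exprn_even_ge0.
apply: addr_ge0; first by rewrite mulr_ge0 // subr_ge0.
rewrite divr_ge0 // subr_ge0.
(* One factor increases in [x] and the other decreases, so on [[p, q]] the product is at least the
   first at [p] times the second at [q]. Three such intervals cover [[1/4, 1]]. *)
have bound (p q : R) : 0 <= p -> p <= x -> x <= q -> q <= 1 ->
    1 <= p ^+ 2 * (16 * (1 - q) + (1 - q ^+ 2) + 5) ->
    1 <= x ^+ 2 * (16 * (1 - x) + (1 - x ^+ 2) + 5).
  move=> p0 px xq q1 /le_trans; apply.
  have pxx : p ^+ 2 <= x ^+ 2 by rewrite lerXn2r ?nnegrE //; lra.
  have xqq : x ^+ 2 <= q ^+ 2 by rewrite lerXn2r ?nnegrE //; lra.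
  have qq : q ^+ 2 <= 1 by rewrite expr_le1 //; lra.
  by apply: ler_pM => //; [exact: sqr_ge0 | lra | lra].
have [x3|/ltW x3] := leP x (1 / 3).
  by apply: (bound (1 / 4) (1 / 3)) => //; lra.
have [x2|/ltW x2] := leP x (1 / 2).
  by apply: (bound (1 / 3) (1 / 2)) => //; lra.
by apply: (bound (1 / 2) 1) => //; lra.
Qed.

Lemma Ups_ge x : - 1 <= Ups x.
Proof.
rewrite /Ups; have := xlor_ge x; have := lor_gt0 x; have := sqr_ge0 (x - 1).
rewrite sqrrB; lra.
Qed.

Lemma Ups0 : Ups 0 = 1 / 2.
Proof. by rewrite /Ups /xlor /lor expr0n /= addr0 invr1; lra. Qed.

Lemma lor_lip x y : `|lor x - lor y| <= 2 * `|x - y|.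
Proof.
rewrite lorB normrM normrN mulrC ler_wpM2r //.
have := xlor_le x; have := xlor_ge x; have := lor_gt0 x; have := lor_le1 x.
have := xlor_le y; have := xlor_ge y; have := lor_gt0 y; have := lor_le1 y.
by move=> *; rewrite ler_norml; apply/andP; split; nra.
Qed.

Lemma xlor_lip x y : `|xlor x - xlor y| <= 2 * `|x - y|.
Proof.
rewrite xlorB normrM mulrC ler_wpM2r //.
have := xlor_le x; have := xlor_ge x; have := lor_gt0 x; have := lor_le1 x.
have := xlor_le y; have := xlor_ge y; have := lor_gt0 y; have := lor_le1 y.
by move=> *; rewrite ler_norml; apply/andP; split; nra.
Qed.

Lemma mul_lip (a b a' b' d e e' : R) : `|a| <= 1 -> `|b'| <= 1 ->
  `|a - a'| <= e * d -> `|b - b'| <= e' * d -> `|a * b - a' * b'| <= (e + e') * d.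
Proof.
move=> a1 b1 ha hb; have -> : a * b - a' * b' = a * (b - b') + (a - a') * b' by ring.
apply: (le_trans (ler_normD _ _)); rewrite !normrM mulrDl addrC lerD //.
  by rewrite -[leRHS]mulr1 ler_pM.
by rewrite -[leRHS]mul1r ler_pM.
Qed.

Lemma lor_norm x : `|lor x| <= 1.
Proof. by rewrite ger0_norm ?lor_le1 // ltW ?lor_gt0. Qed.

Lemma xlor_norm x : `|xlor x| <= 1.
Proof. by rewrite ler_norml; have := xlor_le x; have := xlor_ge x; lra. Qed.

Lemma norm_mul_le1 (a b : R) : `|a| <= 1 -> `|b| <= 1 -> `|a * b| <= 1.
Proof. by move=> a1 b1; rewrite normrM mulr_ile1. Qed.

Lemma ler_normD_trans (a b c d : R) : `|a| <= c -> `|b| <= d -> `|a + b| <= c + d.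
Proof. by move=> h k; apply: (le_trans (ler_normD _ _)); exact: lerD. Qed.

(** Each quadratic term has constant 2 + 2 by [mul_lip] and the linear term has 1: 13 = 1 + 3 *
    4. *)
Lemma dUps_lip x y : `|dUps x - dUps y| <= 13 * `|x - y|.
Proof.
have lu := lor_lip x y; have lw := xlor_lip x y.
have nu z := lor_norm z; have nw z := xlor_norm z.
have h1 := mul_lip (nu x) (nu y) lu lu.
have h2 := mul_lip (nw x) (nw y) lw lw.
have h3 := mul_lip (nu x) (nw y) lu lw.
move: h1 h2 h3; rewrite /dUps !ler_norml => /andP[? ?] /andP[? ?] /andP[? ?].
have := ler_norm (x - y); have := ler_norm (- (x - y)).
by rewrite normrN => ? ?; apply/andP; split; rewrite !expr2; lra.
Qed.

(** Each cubic monomial has constant 6, and the coefficients 6, 2, 3, 1 sum to 12. *)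
Lemma ddUps_lip x y : `|ddUps x - ddUps y| <= 72 * `|x - y|.
Proof.
have lu := lor_lip x y; have lw := xlor_lip x y.
have nu z := lor_norm z; have nw z := xlor_norm z.
have h1 := mul_lip (nu x) (nu y) lu lu.
have h2 := mul_lip (nw x) (nw y) lw lw.
have h3 := mul_lip (norm_mul_le1 (nu x) (nu x)) (nw y) h1 lw.
have h4 := mul_lip (norm_mul_le1 (nw x) (nw x)) (nw y) h2 lw.
have h5 := mul_lip (norm_mul_le1 (nw x) (nw x)) (nu y) h2 lu.
have h6 := mul_lip (norm_mul_le1 (nu x) (nu x)) (nu y) h1 lu.
move: h3 h4 h5 h6; rewrite /ddUps !ler_norml.
move=> /andP[? ?] /andP[? ?] /andP[? ?] /andP[? ?].
by apply/andP; split; rewrite !exprS !expr0; lra.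
Qed.

Lemma is_derive_lor x : is_derive x 1 lor (- 2 * lor x * xlor x).
Proof.
have n0 : 1 + x ^+ 2 != 0 by rewrite gt_eqF ?lor_den_gt0.
have h : is_derive x 1 (fun x : R => 1 + x ^+ 2) (2 * x).
  by apply: is_derive_eq; rewrite /GRing.scale /=
    add0r mul1r mulr1 [2]mulr2n mulrDl mul1r.
have k := @is_deriveV R (fun x : R => 1 + x ^+ 2) x _ 1 n0 h.
rewrite /lor; apply: is_derive_eq; rewrite /xlor /lor /GRing.scale /=.
by field.
Qed.

Lemma is_derive_xlor x : is_derive x 1 xlor (lor x ^+ 2 - xlor x ^+ 2).
Proof.
have h := is_derive_lor x.
have -> : is_derive x (1 : R) xlor = is_derive x (1 : R) (id * lor) by [].
apply: is_derive_eq; rewrite /xlor /lor /GRing.scale /=.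
by field; rewrite gt_eqF ?lor_den_gt0.
Qed.

Lemma is_derive_Ups x : is_derive x 1 Ups (dUps x).
Proof.
have h := is_derive_lor x; have k := is_derive_xlor x.
rewrite /Ups; apply: is_derive_eq.
rewrite /dUps /xlor /lor /GRing.scale /=.
by field; rewrite gt_eqF ?lor_den_gt0.
Qed.

Lemma is_derive_dUps x : is_derive x 1 dUps (ddUps x).
Proof.
have h := is_derive_lor x; have k := is_derive_xlor x.
rewrite /dUps; apply: is_derive_eq.
rewrite /ddUps /xlor /lor /GRing.scale /=.
by field; rewrite gt_eqF ?lor_den_gt0.
Qed.

End Well.

(** * Near-stationary points of the primal chain *)

Section Stationarity.
Variable R : realType.
Variables (a : R) (X : nat -> R) (T : nat) (G : R).

(* [X] is the chain with [s = 1], and [resid] its gradient written as a discrete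
   second-order equation for [X] with forcing [- a ^+ 2 * dUps]. *)
Definition slope i : R := if i is j.+1 then X j - X j.+1 else a * (1 - X 0%N).
Definition resid i : R := slope i.+1 - slope i + a ^+ 2 * dUps (X i).

Hypotheses (a_gt0 : 0 < a) (a_le1 : a <= 1).
Hypothesis X0 : forall i, (T <= i)%N -> X i = 0.
Hypothesis resid_le : forall n, \sum_(0 <= i < n) resid i ^+ 2 <= G.
Hypothesis G_small : 256 * 256 * G < a ^+ 3.

(** The threshold slope: once reached below level 3/4, it is never lost by more than half. *)
Let s := a / 16.
Let cumul n := \sum_(0 <= i < n) resid i ^+ 2.

Let cumulS n : cumul n.+1 = cumul n + resid n ^+ 2.
Proof. by rewrite /cumul big_nat_recr. Qed.

Let cumul_ge0 n : 0 <= cumul n.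
Proof. by apply: sumr_ge0 => i _; exact: sqr_ge0. Qed.

Let slopeS i : slope i.+1 = slope i + resid i - a ^+ 2 * dUps (X i).
Proof. by rewrite /resid; ring. Qed.

Let s_gt0 : 0 < s. Proof. by rewrite divr_gt0. Qed.

(** Young's inequality with weight [s ^+ 2 / 16] charges [4 / s ^+ 2] times the squared residual. As
    256 * 256 = 16^4, all charges together cost at most a quarter of the threshold. *)
Let CS n : 4 / s ^+ 2 * cumul n <= s / 4.
Proof.
have h : cumul n <= s ^+ 3 / 16.
  apply: (le_trans (resid_le n)); move: G_small; rewrite /s expr_div_n.
  by lra.
have -> : 4 / s ^+ 2 * cumul n = (4 * cumul n) / s ^+ 2 by field; rewrite gt_eqF.
rewrite ler_pdivrMr ?exprn_gt0 //; have -> : s / 4 * s ^+ 2 = s ^+ 3 / 4 by ring.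
by lra.
Qed.

(* Young's inequality *)
Let residY i (e : R) : 0 < e -> - e - resid i ^+ 2 / (4 * e) <= resid i.
Proof.
move=> e0; rewrite -subr_ge0.
have -> : resid i - (- e - resid i ^+ 2 / (4 * e)) =
  (resid i + 2 * e) ^+ 2 / (4 * e) by field; rewrite gt_eqF.
by rewrite divr_ge0 ?sqr_ge0 // mulr_ge0 // ltW.
Qed.

(* Once the slope reaches order [a], a small residual cannot bring it back to
   [0]: the part of the well where the forcing vanishes is crossed in
   [O(1 / a)] steps, and elsewhere the forcing only increases the slope. *)
Lemma slope_persists k : s <= slope k -> (forall i, (k <= i)%N -> X i < 3 / 4) ->
  forall i, (k <= i)%N -> s / 2 <= slope i.+1.
Proof.
move=> sk Xk; have sp := s_gt0; have ap := a_gt0; have al := a_le1.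
pose C := 4 / s ^+ 2; pose b := s / 8.
have b0 : 0 < b by rewrite /b divr_gt0.
have s1 : s <= 1 / 16 by rewrite /s; have := a_le1; lra.
have bs : b * (1 + s / 2) <= s / 4.
  by rewrite /b -subr_ge0 (_ : _ - _ = s * (2 - s) / 16); [nra | field].
(* Inside the window [X i >= - 1/4 - s / 2] the loss is paid by the distance travelled below 3/4, at
   rate [b]; past it, the loss is capped by the width of the window. By [bs] and [CS] both bounds
   keep the slope above [s / 2]. *)
pose inv i := s - b * (1 + s / 2) - C * cumul i <= slope i /\
  (- (1 / 4) <= X i + s / 2 -> s - b * (3 / 4 - X i) - C * cumul i <= slope i).
have C0 : 0 < C by rewrite /C divr_gt0 // exprn_gt0.
have step i : (k <= i)%N -> inv i -> inv i.+1 /\ s / 2 <= slope i.+1.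
  move=> ki [h1 h2]; have Xi := Xk _ ki.
  have cs : C * cumul i.+1 <= s / 4 by exact: CS.
  have r2 : C * cumul i.+1 = C * cumul i + C * resid i ^+ 2 by rewrite cumulS mulrDr.
  have [Xlt|Xge] := ltP (X i) (- (1 / 4)).
    have h3 : slope i - C * resid i ^+ 2 <= slope i.+1.
      rewrite slopeS.
      (* The Young weight equals the guaranteed gain from the forcing, so only the squared residual
         is lost. *)
      have e0 : 0 < a ^+ 2 / 8 by rewrite divr_gt0 // exprn_gt0.
      have := residY i e0.
      have : a ^+ 2 * dUps (X i) <= a ^+ 2 * - (1 / 8).
        by rewrite ler_pM2l ?exprn_gt0 // dUps_le //; left; exact: ltW.
      have -> : resid i ^+ 2 / (4 * (a ^+ 2 / 8)) = C * resid i ^+ 2 / 512.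
        by rewrite /C /s; field; rewrite gt_eqF.
      have : 0 <= C * resid i ^+ 2 by rewrite mulr_ge0 ?sqr_ge0 // ltW.
      by lra.
    have h4 : s / 2 <= slope i.+1 by lra.
    split=> //; split; first by lra.
    (* The step goes down by at least [s / 2] from below - 1/4, so the second half of [inv] becomes
       vacuous. *)
    have -> : X i.+1 = X i - slope i.+1 by rewrite /slope; ring.
    by lra.
  have Xi2 : - (1 / 4) <= X i + s / 2 by lra.
  have {}h2 := h2 Xi2.
  have h3 : slope i - b * (s / 2) - C * resid i ^+ 2 <= slope i.+1.
    have e0 : 0 < b * (s / 2) by rewrite mulr_gt0 // divr_gt0.
    have := residY i e0; rewrite slopeS.
    have : a ^+ 2 * dUps (X i) <= 0.
      by rewrite mulr_ge0_le0 ?sqr_ge0 // dUps_le0 //; lra.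
    have -> : resid i ^+ 2 / (4 * (b * (s / 2))) = C * resid i ^+ 2.
      by rewrite /C /b; field; rewrite gt_eqF.
    by lra.
  have bX : b * (3 / 4 - X i) <= b * 1 by rewrite ler_pM2l //; lra.
  have h4 : s / 2 <= slope i.+1 by lra.
  split=> //; split; first by lra.
  move=> _.
  have -> : X i.+1 = X i - slope i.+1 by rewrite /slope; ring.
  have : b * (s / 2) <= b * slope i.+1 by rewrite ler_pM2l.
  by lra.
have inv_k : inv k.
  have ck := cumul_ge0 k; have cs0 : 0 <= C * cumul k by rewrite mulr_ge0 // ltW.
  have bp : 0 <= b * (1 + s / 2) by rewrite mulr_ge0 // ltW //; lra.
  have bX : 0 <= b * (3 / 4 - X k).
    by rewrite mulr_ge0 ?subr_ge0 // ltW // Xk.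
  by split; lra.
have all_inv i : (k <= i)%N -> inv i.
  elim: i => [|i IH]; first by rewrite leqn0 => /eqP <-.
  rewrite leq_eqVlt => /predU1P[<- //|ki].
  by have [] := step i ki (IH ki).
by move=> i ki; have [] := step i ki (all_inv i ki).
Qed.

(** A slope that persists contradicts the zero tail. If no site reaches 3/4, the first slope is
    already large; otherwise, after the last such site, slopes below the threshold keep [X] above
    1/4 long enough for the forcing to push the slope over the threshold. *)
Lemma small_resid_absurd : False.
Proof.
have sp := s_gt0; have ap := a_gt0; have al := a_le1.
have bad k : s <= slope k -> (forall i, (k <= i)%N -> X i < 3 / 4) -> False.
  (* From [maxn k T] on both neighbours are 0, so the slope there is 0. *)
  move=> sk Xk; have := slope_persists sk Xk (leq_maxl k T).
  rewrite /slope !X0 ?leq_maxr ?leqW ?leq_maxr //.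
  by have := s_gt0; lra.
have s1 : s <= 1 / 16 by rewrite /s; have := a_le1; lra.
have [[j Xj]|noj] := pselect (exists j, 3 / 4 <= X j); last first.
  have Xl i : X i < 3 / 4.
    by rewrite ltNge; apply/negP => h; apply: noj; exists i.
  apply: (@bad 0%N) => //.
  by have := Xl 0%N; rewrite /slope /s; nra.
have exj : exists j, 3 / 4 <= X j by exists j.
have ubj i : 3 / 4 <= X i -> (i <= T)%N.
  by move=> Xi; rewrite leqNgt; apply/negP => /ltnW /X0 X0i; lra.
case: (ex_maxnP exj ubj) => {Xj}j Xj jmax.
have Xl i : (j < i)%N -> X i < 3 / 4.
  by move=> ji; rewrite ltNge; apply/negP => /jmax; rewrite leqNgt ji.
have slope_lt i : (j < i)%N -> slope i < s.
  move=> ji; rewrite ltNge; apply/negP => sl; apply: (bad i sl) => k ik.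
  by apply: Xl; exact: leq_trans ik.
(* While [n * s <= 1/2] the chain stays in [[1/4, 3/4)], where the forcing gives [a ^+ 2 / 8] per
   step; half of it is spent as the Young weight. *)
have XN n : n%:R * s <= 1 / 2 -> 3 / 4 - n%:R * s <= X (j + n)%N /\
    n%:R * a ^+ 2 / 16 - 4 / a ^+ 2 * cumul (j + n).+1 <= slope (j + n).+1.
  elim: n => [|n IH].
    move=> _; rewrite addn0 !mul0r subr0; split=> //.
    rewrite sub0r; apply: (@le_trans _ _ 0).
      by rewrite oppr_le0 mulr_ge0 // divr_ge0 // ltW // exprn_gt0.
    by rewrite /slope subr_ge0 ltW // (lt_le_trans (Xl j.+1 _)).
  rewrite -addn1 natrD mulrDl mul1r => ns.
  have [|h1 h2] := IH; first by have := s_gt0; lra.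
  rewrite addn1 addnS.
  have l1 : slope (j + n).+1 < s by apply: slope_lt; rewrite ltnS leq_addr.
  have XE : X (j + n).+1 = X (j + n)%N - slope (j + n).+1.
    by rewrite /slope; ring.
  have X1 : 3 / 4 - (n%:R * s + s) <= X (j + n).+1 by rewrite XE; lra.
  split; first by lra.
  rewrite slopeS cumulS.
  have e0 : 0 < a ^+ 2 / 16 by rewrite divr_gt0 // exprn_gt0.
  have := residY (j + n).+1 e0.
  have : a ^+ 2 * dUps (X (j + n).+1) <= a ^+ 2 * - (1 / 8).
    rewrite ler_pM2l ?exprn_gt0 // dUps_le //; right; apply/andP; split.
      by lra.
    by have := Xl (j + n).+1; rewrite ltnS leq_addr => /(_ isT); lra.
  have -> : resid (j + n).+1 ^+ 2 / (4 * (a ^+ 2 / 16)) =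
      4 / a ^+ 2 * resid (j + n).+1 ^+ 2 by field; rewrite gt_eqF.
  by lra.
(* The longest admissible run, about [8 / a] steps; it lifts the slope to at least about [4 * s]. *)
pose n := Num.truncn (1 / 2 / s).
have /andP[n1 n2] : n%:R <= 1 / 2 / s < n.+1%:R.
  by apply: truncn_itv; rewrite divr_ge0 // ltW.
have ns : n%:R * s <= 1 / 2 by rewrite -ler_pdivlMr.
have ns1 : 1 / 2 < n%:R * s + s.
  by move: n2; rewrite ltr_pdivrMr // -natr1; lra.
have [_] := XN n ns.
have : slope (j + n).+1 < s by apply: slope_lt; rewrite ltnS leq_addr.
have := CS (j + n).+1.
have -> : 4 / a ^+ 2 * cumul (j + n).+1 = 4 / s ^+ 2 * cumul (j + n).+1 / 256.
  by rewrite /s; field; rewrite gt_eqF.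
have -> : n%:R * a ^+ 2 / 16 = 16 * s * (n%:R * s) by rewrite /s; field.
have : 16 * s * (1 / 4) <= 16 * s * (n%:R * s) by rewrite ler_pM2l ?mulr_gt0 //; lra.
by have := s_gt0; lra.
Qed.

End Stationarity.

Lemma resid_lower_bound (R : realType) (a : R) (X : nat -> R) T (G : R) :
  0 < a -> a <= 1 -> (forall i, (T <= i)%N -> X i = 0) ->
  (forall n, \sum_(0 <= i < n) resid a X i ^+ 2 <= G) -> a ^+ 3 <= 256 * 256 * G.
Proof.
by move=> a0 a1 X0 GX; rewrite leNgt; apply/negP; exact: small_resid_absurd X0 GX.
Qed.

(** * Functions with nearest-neighbour interactions *)

Lemma is_diff_linear (V W : normedModType Rr) (f : {linear V -> W}) x :
  continuous f -> is_diff x f f.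
Proof.
move=> cf; apply: DiffDef; first exact: linear_differentiable.
exact: diff_lin.
Qed.

(** * Coordinates, chains and their gradients *)

Section Coordinates.
Variable n : nat.
Implicit Types (x v : 'rV[Rr]_n) (p : nat).

(* Out-of-range coordinates are [0], which encodes the boundary condition at
   the end of a chain. *)
Definition coef x p : Rr := if insub p is Some i then x ord0 i else 0.

Lemma coef_ord x (i : 'I_n) : coef x i = x ord0 i.
Proof. by rewrite /coef valK. Qed.

Lemma coef_out x p : (n <= p)%N -> coef x p = 0.
Proof. by move=> np; rewrite /coef insubF // ltnNge np. Qed.

Lemma coef0 p : coef 0 p = 0.
Proof. by rewrite /coef; case: insub => // i; rewrite mxE. Qed.

Lemma coefD x v p : coef (x + v) p = coef x p + coef v p.
Proof. by rewrite /coef; case: insub => [i|]; rewrite ?mxE ?addr0. Qed.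

Lemma coefZ (a : Rr) x p : coef (a *: x) p = a * coef x p.
Proof. by rewrite /coef; case: insub => [i|]; rewrite ?mxE ?mulr0. Qed.

Lemma coefB x v p : coef (x - v) p = coef x p - coef v p.
Proof. by rewrite -[- v]scaleN1r coefD coefZ mulN1r. Qed.

Lemma coef_delta (i : 'I_n) p : coef (delta_mx ord0 i) p = (p == i)%:R.
Proof.
have [pn|np] := ltnP p n.
  by rewrite -[p]/(val (Ordinal pn)) coef_ord mxE eqxx -val_eqE /=.
rewrite coef_out // gtn_eqF //; exact: leq_trans (ltn_ord i) np.
Qed.

Lemma enorm_sqr x : enorm x ^+ 2 = \sum_(0 <= p < n) coef x p ^+ 2.
Proof.
rewrite /enorm sqr_sqrtr; last by apply: sumr_ge0 => i _; exact: sqr_ge0.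
by rewrite big_mkord; apply: eq_bigr => i _; rewrite coef_ord.
Qed.

Lemma enorm_ge0 x : 0 <= enorm x.
Proof. exact: sqrtr_ge0. Qed.

Lemma coef_le_enorm x p : `|coef x p| <= enorm x.
Proof.
have [pn|/coef_out ->] := ltnP p n; last by rewrite normr0 enorm_ge0.
rewrite -[leLHS]ger0_norm // -ler_sqr ?nnegrE ?enorm_ge0 // normr_id.
rewrite enorm_sqr real_normK ?num_real //.
rewrite (big_cat_nat (leq0n p) (ltnW pn)) /= [X in _ + X]big_ltn // addrCA lerDl.
by rewrite addr_ge0 // sumr_ge0 // => i _; exact: sqr_ge0.
Qed.

Lemma is_diff_coef x p :
  is_diff x (fun z : 'rV[Rr]_n => coef z p : Rr^o) (fun z => coef z p).
Proof.
have lin : linear (fun z : 'rV[Rr]_n => coef z p : Rr^o).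
  by move=> a u v; rewrite coefD coefZ.
pose fl := GRing.isLinear.Build _ _ _ _ _ lin.
pose f : {linear 'rV[Rr]_n -> Rr^o} := HB.pack (fun z : 'rV[Rr]_n => coef z p : Rr^o) fl.
have cf : continuous f.
  rewrite /f /= /coef; case: insub => [i|]; last exact: cst_continuous.
  exact: coord_continuous.
exact: (@is_diff_linear _ _ f).
Qed.

End Coordinates.

Lemma is_diff_derive1 (h : Rr -> Rr) (x dh : Rr) :
  is_derive (x : Rr^o) 1 (h : Rr^o -> Rr^o) dh ->
  is_diff (x : Rr^o) (h : Rr^o -> Rr^o) (fun v : Rr^o => dh * v : Rr^o).
Proof.
move=> [dx <-]; apply: DiffDef; first exact/derivable1_diffP.
by rewrite deriv1E // derive1E; apply/funext => v; rewrite /GRing.scale /= mulrC.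
Qed.

Definition chain (T : nat) (h : nat -> Rr -> Rr) (c : nat -> Rr)
    (z : nat -> Rr) : Rr :=
  \sum_(0 <= p < T) (h p (z p) + c p * (z p * z p.+1)).

Definition chain_grad (dh : nat -> Rr -> Rr) (c z : nat -> Rr) (p : nat) : Rr :=
  dh p (z p) + c p * z p.+1 + (if p is q.+1 then c q * z q else 0).

(** Summation by parts; [v T = 0] removes the boundary term, which the induction has to carry. *)
Lemma chain_gradE T dh c z v : v T = 0 ->
  \sum_(0 <= p < T) (dh p (z p) * v p + c p * (z p * v p.+1 + z p.+1 * v p)) =
  \sum_(0 <= p < T) chain_grad dh c z p * v p.
Proof.
move=> vT.
suff -> : \sum_(0 <= p < T) chain_grad dh c z p * v p =
   \sum_(0 <= p < T) (dh p (z p) * v p + c p * (z p * v p.+1 + z p.+1 * v p))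
   - (if T is q.+1 then c q * z q else 0) * v T by rewrite vT mulr0 subr0.
elim: T {vT} => [|T IH]; first by rewrite !big_nil mul0r subr0.
rewrite !big_nat_recr //= IH /chain_grad.
set m := (match T with 0%N => 0 | _ => _ end).
set sm := \sum_(0 <= i < T) _; clearbody m sm.
by ring.
Qed.

(** The coordinates are arbitrary differentiable functions, so that the lemma serves for the pair
    [(x, y)], for one variable with the other frozen, and for the spaced sites. *)
Lemma is_diff_chain (V : normedModType Rr) (T : nat) h dh c
    (z dz : nat -> V -> Rr^o) (x : V) :
  (forall p, is_diff x (z p) (dz p)) ->
  (forall p, is_derive (z p x) 1 (h p : Rr^o -> Rr^o) (dh p (z p x))) ->
  (forall v, dz T v = 0) ->
  is_diff x (fun u => chain T h c (z ^~ u) : Rr^o)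
    (fun v => \sum_(0 <= p < T) chain_grad dh c (z ^~ x) p * dz p v : Rr^o).
Proof.
move=> dzx dhx dzT.
rewrite [X in is_diff _ _ X](_ : _ = fun v => \sum_(0 <= p < T)
  (dh p (z p x) * dz p v + c p * (z p x * dz p.+1 v + z p.+1 x * dz p v)) : Rr^o);
  last first.
  by apply/funext => v; rewrite (chain_gradE dh c (z ^~ x) (dzT v)).
rewrite /chain {dzT}; elim: T => [|T IH].
  under eq_fun do rewrite big_nil.
  rewrite [X in is_diff _ _ X](_ : _ = fun=> 0); last first.
    by apply/funext => v; rewrite big_nil.
  exact: is_diff_cst.
under eq_fun do rewrite big_nat_recr //=.
rewrite [X in is_diff _ _ X](_ : _ = (fun v => \sum_(0 <= p < T)
  (dh p (z p x) * dz p v + c p * (z p x * dz p.+1 v + z p.+1 x * dz p v)) : Rr^o)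
  + ((fun v => dh T (z T x) * v : Rr^o) \o dz T +
    c T *: (z T x *: dz T.+1 + z T.+1 x *: dz T))); last first.
  by apply/funext => v; rewrite big_nat_recr.
have h1 : is_diff x (h T \o z T : V -> Rr^o) ((fun v => dh T (z T x) * v : Rr^o) \o dz T).
  by apply: is_diff_comp; exact: is_diff_derive1.
have h2 : is_diff x (z T * z T.+1) (z T x *: dz T.+1 + z T.+1 x *: dz T).
  exact: is_diffM.
exact: (is_diffD IH (is_diffD h1 (is_diffZ (c T) h2))).
Qed.

Lemma grad_is_diff n (g : 'rV[Rr]_n -> Rr^o) x (dg : 'rV[Rr]_n -> Rr^o) :
  is_diff x g dg -> grad g x = \row_i dg (delta_mx ord0 i).
Proof.
move=> [dx <-]; apply/rowP => i; rewrite !mxE.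
by rewrite deriveE.
Qed.

Lemma big_delta N (F : nat -> Rr) (i : 'I_N) :
  \sum_(0 <= p < N) F p * (p == i)%:R = F i.
Proof.
rewrite big_mkord (bigD1 i) //= eqxx mulr1 big1 ?addr0 // => j /negPf ji.
by rewrite -[_ == _]/(j == i) ji mulr0.
Qed.

(** * Zero-respecting algorithms on interleaved chains *)

Section Saddle.
Variables (N : nat) (sel : pred nat).
Variables (h dh : nat -> Rr -> Rr) (c : nat -> Rr) (mu : Rr).
Implicit Types (x y : 'rV[Rr]_N).

(* The coordinates of [x] outside [sel] and those of [y] inside [sel] are
   dummies: [zsel] interleaves the genuine ones. *)
Definition zsel x y p : Rr := if sel p then coef x p else coef y p.

(** Makes [saddle] strongly concave also in the [y]-coordinates that sit at sites. *)
Definition dummy p (u : Rr) : Rr := - (mu / 2) * ((sel p)%:R * u ^+ 2).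

Definition saddle x y : Rr :=
  chain N h c (zsel x y) + chain N dummy (fun=> 0) (coef y).

Hypothesis dhE : forall p (u : Rr^o), is_derive u 1 (h p : Rr^o -> Rr^o) (dh p u).

Let ddummy p (u : Rr) : Rr := - mu * ((sel p)%:R * u).

Let dummyE p (u : Rr^o) : is_derive u 1 (dummy p : Rr^o -> Rr^o) (ddummy p u).
Proof.
rewrite /dummy; apply: is_derive_eq; rewrite /ddummy /GRing.scale /=.
by rewrite mulr1; field.
Qed.

Lemma saddle_differentiable (z : 'rV[Rr]_N * 'rV[Rr]_N) :
  differentiable (fun w : 'rV[Rr]_N * 'rV[Rr]_N => saddle w.1 w.2 : Rr^o) z.
Proof.
have dx p : is_diff z ((fun u : 'rV[Rr]_N => coef u p : Rr^o) \o fst)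
    ((fun u : 'rV[Rr]_N => coef u p : Rr^o) \o fst).
  apply: is_diff_comp; last exact: is_diff_coef.
  by apply: (@is_diff_linear _ _ fst); move=> u; exact: cvg_fst.
have dy p : is_diff z ((fun u : 'rV[Rr]_N => coef u p : Rr^o) \o snd)
    ((fun u : 'rV[Rr]_N => coef u p : Rr^o) \o snd).
  apply: is_diff_comp; last exact: is_diff_coef.
  by apply: (@is_diff_linear _ _ snd); move=> u; exact: cvg_snd.
have dz p : is_diff z (fun w => zsel w.1 w.2 p : Rr^o) (fun w => zsel w.1 w.2 p : Rr^o).
  by rewrite /zsel; case: (sel p); [exact: dx | exact: dy].
have zN (w : 'rV[Rr]_N * 'rV[Rr]_N) : zsel w.1 w.2 N = 0.
  by rewrite /zsel !coef_out // if_same.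
have d1 := is_diff_chain c dz (fun p => dhE p _) zN.
have d2 := is_diff_chain (fun=> 0) dy (fun p => dummyE p _)
  (fun w : 'rV[Rr]_N * 'rV[Rr]_N => coef_out w.2 (leqnn N)).
by have [] := is_diffD d1 d2.
Qed.

Lemma grad_x_saddle x y : grad_x saddle x y =
  \row_(i < N) if sel i then chain_grad dh c (zsel x y) i else 0.
Proof.
have dz p : is_diff x (fun w => zsel w y p : Rr^o)
    (fun w => if sel p then coef w p else 0 : Rr^o).
  rewrite /zsel; case: (sel p); first exact: is_diff_coef.
  exact: is_diff_cst.
have zN (w : 'rV[Rr]_N) : (if sel N then coef w N else 0) = 0.
  by rewrite coef_out // if_same.
have d1 := is_diff_chain c dz (fun p => dhE p _) zN.
have d2 := is_diffD d1 (is_diff_cst (chain N dummy (fun=> 0) (coef y) : Rr^o) x).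
rewrite /grad_x (grad_is_diff d2); apply/rowP => i; rewrite !mxE /=.
rewrite addr0; under eq_bigr do rewrite coef_delta.
rewrite -[RHS](big_delta (fun p => if sel p then chain_grad dh c (zsel x y) p else 0)).
by apply: eq_bigr => p _; case: (sel p); rewrite ?mulr0 ?mul0r.
Qed.

Lemma grad_y_saddle x y : grad_y saddle x y =
  \row_(i < N) if sel i then - mu * coef y i else chain_grad dh c (zsel x y) i.
Proof.
have dz p : is_diff y (fun w => zsel x w p : Rr^o)
    (fun w => if sel p then 0 else coef w p : Rr^o).
  rewrite /zsel; case: (sel p); last exact: is_diff_coef.
  exact: is_diff_cst.
have zN (w : 'rV[Rr]_N) : (if sel N then 0 else coef w N) = 0.
  by rewrite coef_out // if_same.
have d1 := is_diff_chain c dz (fun p => dhE p _) zN.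
have d2 := is_diff_chain (fun=> 0) (is_diff_coef y) (fun p => dummyE p _)
  (fun w : 'rV[Rr]_N => coef_out w (leqnn N)).
have d3 := is_diffD d1 d2.
rewrite /grad_y (grad_is_diff d3); apply/rowP => i; rewrite !mxE /=.
rewrite -[LHS]/(_ + _) /= -big_split /=; under eq_bigr do rewrite coef_delta.
rewrite -[RHS](big_delta (fun p => if sel p then - mu * coef y p
  else chain_grad dh c (zsel x y) p)).
have ck p : chain_grad ddummy (fun=> 0) (coef y) p = ddummy p (coef y p).
  by rewrite /chain_grad; case: p => [|p]; rewrite /= !mul0r !addr0.
apply: eq_bigr => p _; rewrite ck /ddummy.
by case: (sel p); rewrite ?mul1r ?mul0r ?mulr0 ?mul0r ?add0r ?addr0.
Qed.

Lemma sumsq3_le (a b d : Rr) : (a + b + d) ^+ 2 <= 3 * (a ^+ 2 + b ^+ 2 + d ^+ 2).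
Proof.
rewrite -subr_ge0 (_ : _ - _ = (a - b) ^+ 2 + (b - d) ^+ 2 + (a - d) ^+ 2).
  by rewrite !addr_ge0 ?sqr_ge0.
by ring.
Qed.

Lemma sqr_le_norm (a b : Rr) : `|a| <= b -> a ^+ 2 <= b ^+ 2.
Proof.
move=> ab; rewrite -(real_normK (num_real a)) lerXn2r ?nnegrE //.
exact: le_trans ab.
Qed.

(** A gradient entry sees three sites, which costs the factor 3; summed over the chain, each site is
    counted once as itself and at most once as each neighbour. [z N = z' N] closes the right end. *)
Lemma chain_grad_lip (H B : Rr) (z z' : nat -> Rr) :
  (forall p u u', `|dh p u - dh p u'| <= H * `|u - u'|) ->
  (forall p, `|c p| <= B) -> z N = z' N ->
  \sum_(0 <= p < N) (chain_grad dh c z p - chain_grad dh c z' p) ^+ 2 <=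
  3 * (H ^+ 2 + 2 * B ^+ 2) * \sum_(0 <= p < N) (z p - z' p) ^+ 2.
Proof.
move=> hl cB zN.
pose e p := (z p - z' p) ^+ 2.
have e0 p : 0 <= e p by exact: sqr_ge0.
have cz p q : (c p * z q - c p * z' q) ^+ 2 <= B ^+ 2 * e q.
  rewrite -mulrBr exprMn /e; apply: ler_wpM2r; first exact: sqr_ge0.
  exact: sqr_le_norm.
have hz p : (dh p (z p) - dh p (z' p)) ^+ 2 <= H ^+ 2 * e p.
  rewrite /e -(real_normK (num_real (z p - z' p))) -exprMn.
  exact: sqr_le_norm (hl _ _ _).
have step p : (chain_grad dh c z p - chain_grad dh c z' p) ^+ 2 <=
    3 * (H ^+ 2 * e p + B ^+ 2 * e p.+1 + B ^+ 2 * (if p is q.+1 then e q else 0)).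
  have -> : chain_grad dh c z p - chain_grad dh c z' p =
    (dh p (z p) - dh p (z' p)) + (c p * z p.+1 - c p * z' p.+1) +
    ((if p is q.+1 then c q * z q else 0) - (if p is q.+1 then c q * z' q else 0)).
    by rewrite /chain_grad; case: p => [|p]; ring.
  apply: (le_trans (sumsq3_le _ _ _)); rewrite ler_pM2l //.
  apply: lerD; first exact: lerD.
  by case: p => [|p]; [rewrite subrr expr0n mulr0 | exact: cz].
apply: (le_trans (ler_sum_nat (fun p _ => step p))).
rewrite -mulr_sumr -mulrA ler_pM2l // !big_split /= -!mulr_sumr mulrDl -addrA lerD2l.
rewrite -mulrA mulr_natl mulr2n lerD // ler_wpM2l ?sqr_ge0 //.
  have -> : \sum_(0 <= p < N) e p.+1 = \sum_(0 <= p < N) e p + e N - e 0%N.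
    elim: (N) => [|n IH]; first by rewrite !big_nil add0r subrr.
    by rewrite !big_nat_recr //= IH addrAC.
  by rewrite {2}/e zN subrr expr0n addr0 gerDl oppr_le0.
suff -> : \sum_(0 <= p < N) (if p is q.+1 then e q else 0) =
    \sum_(0 <= p < N) e p - (if N is q.+1 then e q else 0).
  by rewrite gerDl oppr_le0; case: (N).
elim: (N) => [|n IH]; first by rewrite !big_nil subr0.
by rewrite !big_nat_recr //= IH addrK subrK.
Qed.

End Saddle.

Section SaddleFacts.
Variables (N : nat) (sel : pred nat).
Variables (h dh : nat -> Rr -> Rr) (c : nat -> Rr) (mu : Rr).
Hypothesis dhE : forall p (u : Rr^o), is_derive u 1 (h p : Rr^o -> Rr^o) (dh p u).
Local Notation f := (@saddle N sel h c mu).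

Lemma saddle_smooth (H B l : Rr) :
  (forall p u u', `|dh p u - dh p u'| <= H * `|u - u'|) ->
  (forall p, `|c p| <= B) -> 0 <= mu <= l ->
  3 * (H ^+ 2 + 2 * B ^+ 2) <= l ^+ 2 -> smooth l f.
Proof.
move=> hl cB /andP[mu0 mul] HB; split; first exact: saddle_differentiable.
move=> x y x' y'; rewrite !(grad_x_saddle sel c mu dhE) !(grad_y_saddle sel c mu dhE).
rewrite !enorm_sqr -!big_split /= mulr_sumr.
have zN : zsel sel x y N = zsel sel x' y' N by rewrite /zsel !coef_out // !if_same.
pose z := zsel sel x y; pose z' := zsel sel x' y'.
have := chain_grad_lip hl cB zN; rewrite -/z -/z' => cg.
apply: (@le_trans _ _ (\sum_(0 <= p < N)
  ((chain_grad dh c z p - chain_grad dh c z' p) ^+ 2 +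
   (sel p)%:R * (mu ^+ 2 * coef (y - y') p ^+ 2)))).
  apply: ler_sum_nat => p /andP[_ pN].
  rewrite -[p]/(val (Ordinal pN)) !coef_ord !mxE /= -!/z -!/z'.
  rewrite -/z -/z' -!(coef_ord _ (Ordinal pN)) /=.
  case: (sel p); last by rewrite subrr expr0n add0r mul0r addr0.
  by rewrite mul1r -mulrBr exprMn sqrrN.
rewrite big_split /=.
apply: (@le_trans _ _ (\sum_(0 <= p < N)
  (l ^+ 2 * (z p - z' p) ^+ 2 + (sel p)%:R * (l ^+ 2 * coef (y - y') p ^+ 2)))).
  rewrite big_split /= lerD //.
    apply: (le_trans cg); rewrite -mulr_sumr ler_wpM2r //.
    by apply: sumr_ge0 => p _; exact: sqr_ge0.
  apply: ler_sum => p _; rewrite ler_wpM2l //; apply: ler_wpM2r; first exact: sqr_ge0.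
  by rewrite lerXn2r ?nnegrE // (le_trans mu0).
apply: ler_sum => p _; rewrite mulrDr /z /z' /zsel.
case: (sel p); rewrite -coefB ?mul1r // mul0r addr0 lerDr.
by rewrite mulr_ge0 ?sqr_ge0.
Qed.

(** If an iterate vanishes from position [i] on, its gradient vanishes beyond [i], as each entry
    only sees adjacent positions. So one query extends the support by at most one position, whether
    an [x] or a [y]; only position 0 may have a force at 0. *)
Lemma saddle_zero_chain (xs ys : nat -> 'rV[Rr]_N) :
  (forall p, (0 < p)%N -> dh p 0 = 0) -> first_order_iterates f xs ys ->
  forall t p, (t <= p)%N -> zsel sel (xs t) (ys t) p = 0.
Proof.
move=> dh0 [x0 [y0 step]]; elim/ltn_ind => -[_ p _|t IH p tp].
  by rewrite /zsel x0 y0 !coef0 if_same.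
have {step} [stepx stepy] := step t.
have [pN|Np] := ltnP p N; last by rewrite /zsel !coef_out // if_same.
have cg0 i : (i <= t)%N -> chain_grad dh c (zsel sel (xs i) (ys i)) p = 0.
  move=> it; have z0 q : (i <= q)%N -> zsel sel (xs i) (ys i) q = 0.
    by move=> iq; exact: IH.
  have ip : (i < p)%N by exact: leq_ltn_trans tp.
  rewrite /chain_grad !z0 ?(ltnW ip) ?(leqW (ltnW ip)) // dh0 ?(leq_ltn_trans _ ip) //.
  rewrite mulr0 !add0r; case: p ip {tp pN} => // q iq.
  by rewrite z0 ?mulr0.
rewrite /zsel -[p in coef _ p]/(val (Ordinal pN)) -[p in coef (ys _) p]/(val (Ordinal pN)).
rewrite !coef_ord.
case sp : (sel p); apply/eqP; apply: contraT.
  move=> /stepx [i it]; have := IH i it p (leq_trans (leq_trans it (leqnSn t)) tp).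
  rewrite /zsel sp -[p]/(val (Ordinal pN)) coef_ord => ->.
  rewrite (grad_x_saddle sel c mu dhE) mxE /= sp cg0 //.
  by case; rewrite eqxx.
move=> /stepy [i it]; have := IH i it p (leq_trans (leq_trans it (leqnSn t)) tp).
rewrite /zsel sp -[p]/(val (Ordinal pN)) coef_ord => ->.
rewrite (grad_y_saddle sel c mu dhE) mxE /= sp cg0 //.
by case; rewrite eqxx.
Qed.

End SaddleFacts.

(** * The primal function *)

Section SpacedChain.
Variables (P T : nat) (h dh ddh : nat -> Rr -> Rr) (c : nat -> Rr).
Hypothesis P_gt0 : (0 < P)%N.
Hypothesis dhE : forall p (u : Rr^o), is_derive u 1 (h p : Rr^o -> Rr^o) (dh p u).
Hypothesis ddhE : forall p (u : Rr^o), is_derive u 1 (dh p : Rr^o -> Rr^o) (ddh p u).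
Local Notation N := (P * T)%N.
Implicit Types x v : 'rV[Rr]_N.

(* The sites of the primal chain are the [x]-coordinates at multiples of the
   period [P]; the [P - 1] positions in between are for the [y]-variables. *)
Definition spaced x i : Rr := coef x (P * i).

Definition spaced_chain x : Rr := chain T h c (spaced x).

Lemma is_diff_spaced_chain x : is_diff x (spaced_chain : _ -> Rr^o)
  (fun v => \sum_(0 <= i < T) chain_grad dh c (spaced x) i * spaced v i : Rr^o).
Proof.
exact: (is_diff_chain c (fun i => is_diff_coef x (P * i)) (fun i => dhE i _)
  (fun v => coef_out v (leqnn N))).
Qed.

Lemma grad_spaced_chain x : grad spaced_chain x =
  \row_(p < N) if (P %| p)%N then chain_grad dh c (spaced x) (p %/ P)%N else 0.
Proof.
rewrite (grad_is_diff (is_diff_spaced_chain x)); apply/rowP => p; rewrite !mxE.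
under eq_bigr do rewrite /spaced coef_delta.
case: ifPn => [Pp|nPp].
  have iT : (p %/ P < T)%N by rewrite ltn_divLR // [ltnRHS]mulnC ltn_ord.
  rewrite -[RHS](big_delta (chain_grad dh c (spaced x)) (Ordinal iT)) /=.
  by apply: eq_bigr => i _; rewrite -[in RHS](eqn_pmul2l P_gt0) [(P * (_ %/ _))%N]mulnC divnK.
rewrite big1 // => i _; rewrite (_ : (_ == _) = false) ?mulr0 //.
by apply: contraNF nPp => /eqP <-; exact: dvdn_mulr.
Qed.

(** The Hessian is tridiagonal with constant off-diagonal entries, so the difference of two Hessians
    is diagonal and its norm is the largest entry. *)
Lemma spaced_chain_hessian_lipschitz L :
  (forall p u u', `|ddh p u - ddh p u'| <= L * `|u - u'|) ->
  hessian_lipschitz L spaced_chain.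
Proof.
move=> ddl.
have L0 : 0 <= L.
  have := ddl 0%N 1 0; rewrite subr0 normr1 mulr1; exact: le_trans.
pose H x v i := ddh i (spaced x i) * spaced v i + c i * spaced v i.+1 +
   (if i is j.+1 then c j * spaced v j else 0).
have dg x (p : 'I_N) : is_diff x (fun x => grad spaced_chain x ord0 p : Rr^o)
   (fun v => if (P %| p)%N then H x v (p %/ P)%N else 0 : Rr^o).
  under eq_fun do rewrite grad_spaced_chain mxE.
  case: (P %| p)%N; last exact: is_diff_cst.
  rewrite /chain_grad /H; set i := (p %/ P)%N.
  have ds j : is_diff x (fun z => spaced z j : Rr^o) (fun z => spaced z j : Rr^o).
    exact: is_diff_coef.
  have d1 : is_diff x (fun z => dh i (spaced z i) : Rr^o)
      (fun v => ddh i (spaced x i) * spaced v i : Rr^o).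
    exact: (is_diff_comp (ds i) (is_diff_derive1 (ddhE i _))).
  have d2 := is_diffD d1 (is_diffZ (c i) (ds i.+1)).
  case: i d2 {d1} => [|i] d2; first exact: (is_diffD d2 (is_diff_cst (0 : Rr^o) x)).
  exact: (is_diffD d2 (is_diffZ (c i) (ds i))).
have gE : grad spaced_chain = \sum_(p < N)
    (fun x => (grad spaced_chain x ord0 p : Rr^o) *: (delta_mx ord0 p : 'rV[Rr]_N)).
  by apply/funext => x; rewrite fct_sumE -row_sum_delta.
have dgrad x : differentiable (grad spaced_chain) x.
  rewrite gE; apply: differentiable_sum => p.
  by apply: differentiableZl; have [] := dg x p.
split; first by move=> x; have [] := is_diff_spaced_chain x.
split=> // x x' v.
have DE z : derive (grad spaced_chain) z v =
    \row_(p < N) (if (P %| p)%N then H z v (p %/ P)%N else 0).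
  rewrite derive_mx; last exact: diff_derivable.
  apply/rowP => p; rewrite !mxE; have [dp dv] := dg z p.
  by rewrite deriveE // dv.
rewrite !DE -ler_sqr ?nnegrE ?mulr_ge0 ?enorm_ge0 //.
rewrite exprMn !enorm_sqr mulr_sumr; apply: ler_sum_nat => q /andP[_ qN].
rewrite -[q]/(val (Ordinal qN)) coef_ord !mxE /=.
case: ifPn => [Pq|_]; last by rewrite subrr expr0n mulr_ge0 ?sqr_ge0.
set i := (q %/ P)%N.
have iE : (P * i)%N = q by rewrite mulnC divnK.
have -> : H x v i - H x' v i = (ddh i (spaced x i) - ddh i (spaced x' i)) * spaced v i.
  by rewrite /H; case: (i) => [|j]; ring.
have sv : spaced v i = coef v q by rewrite /spaced iE.
rewrite exprMn sv; apply: ler_wpM2r; first exact: sqr_ge0.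
apply: sqr_le_norm; apply: (le_trans (ddl _ _ _)); rewrite ler_wpM2l //.
by rewrite /spaced -coefB coef_le_enorm.
Qed.

Lemma big_blocks (F : nat -> Rr) :
  \sum_(0 <= p < N) F p = \sum_(0 <= i < T) \sum_(0 <= k < P) F (P * i + k)%N.
Proof.
elim: (T) => [|t IH]; first by rewrite muln0 !big_nil.
rewrite big_nat_recr //= -IH mulnS addnC.
rewrite (@big_cat_nat _ _ _ (P * t)%N 0%N (P * t + P)%N) //= ?leq_addr //; congr (_ + _).
by rewrite -{1}[(P * t)%N]add0n big_addn addnC addnK; apply: eq_bigr => k _; rewrite addnC.
Qed.

Lemma enorm_grad_spaced x : enorm (grad spaced_chain x) ^+ 2 =
  \sum_(0 <= i < T) chain_grad dh c (spaced x) i ^+ 2.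
Proof.
rewrite enorm_sqr big_blocks; apply: eq_big_nat => i /andP[_ iT].
rewrite big_ltn // addn0 [X in _ + X]big_nat_cond big1 ?addr0; last first.
  move=> k /andP[/andP[k0 kP] _]; rewrite grad_spaced_chain.
  have pN : (P * i + k < N)%N.
    apply: (@leq_trans (P * i.+1)%N); first by rewrite mulnS addnC ltn_add2r.
    by rewrite leq_pmul2l.
  rewrite -[(P * i + k)%N]/(val (Ordinal pN)) coef_ord mxE /= dvdn_addr ?dvdn_mulr //.
  by rewrite gtnNdvd // expr0n.
rewrite grad_spaced_chain.
have pN : (P * i < N)%N by rewrite ltn_pmul2l.
by rewrite -[(P * i)%N]/(val (Ordinal pN)) coef_ord mxE /= dvdn_mulr // mulKn.
Qed.

End SpacedChain.

(** * Quadratic forms and maximisation over [y] *)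

Section QuadraticForms.
Variable V : lmodType Rr.

(** The equality case of strong convexity along a segment, in the shape that strong concavity
    consumes. *)
Definition is_quadratic (q : V -> Rr) := forall (t : Rr) y y',
  q (t *: y + (1 - t) *: y') = t * q y + (1 - t) * q y' - t * (1 - t) * q (y - y').

Lemma is_quadratic_sqr (L : V -> Rr) :
  (forall a b y y', L (a *: y + b *: y') = a * L y + b * L y') ->
  is_quadratic (fun y => L y ^+ 2).
Proof.
move=> lin t y y'; rewrite lin.
have -> : L (y - y') = L y - L y'.
  by rewrite -[y - y']/(y - y') -[y in LHS]scale1r -scaleN1r lin mul1r mulN1r.
by ring.
Qed.

Lemma is_quadraticD q q' :
  is_quadratic q -> is_quadratic q' -> is_quadratic (fun y => q y + q' y).
Proof. by move=> hq hq' t y y'; rewrite hq hq'; ring. Qed.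

Lemma is_quadraticZ b q : is_quadratic q -> is_quadratic (fun y => b * q y).
Proof. by move=> hq t y y'; rewrite hq; ring. Qed.

Lemma is_quadratic_sum m (q : nat -> V -> Rr) : (forall i, is_quadratic (q i)) ->
  is_quadratic (fun y => \sum_(0 <= i < m) q i y).
Proof.
move=> hq t y y'; elim: m => [|m IH]; first by rewrite !big_nil; ring.
by rewrite !big_nat_recr //= IH hq; ring.
Qed.

End QuadraticForms.

Section Quadratic.
Variables (d e : nat) (f : 'rV[Rr]_d -> 'rV[Rr]_e -> Rr).
Variables (g : 'rV[Rr]_d -> Rr) (w : 'rV[Rr]_d -> 'rV[Rr]_e) (q : 'rV[Rr]_e -> Rr).
Variable mu : Rr.
Hypothesis mu_ge0 : 0 <= mu.
Hypothesis fE : forall x y, f x y = g x - q (y - w x) / 2.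
Hypothesis q_ge : forall y, mu * enorm y ^+ 2 <= q y.
Hypothesis q_quad : is_quadratic q.

Lemma Phi_quadratic : Phi f = g.
Proof.
have q0 : q 0 = 0.
  (* At the midpoint of 0 and 0 the identity reads [q 0 = q 0 - q 0 / 4]. *)
  by have := q_quad (1 / 2) 0 0; rewrite !scaler0 addr0 subr0; lra.
apply/funext => x; rewrite /Phi.
have ub : ubound (range (f x)) (g x).
  move=> _ [y _ <-]; rewrite fE gerBl divr_ge0 //.
  by apply: le_trans (q_ge _); rewrite mulr_ge0 ?sqr_ge0.
apply/eqP; rewrite eq_le; apply/andP; split.
  by apply: ge_sup => //; exists (f x 0); exists 0.
apply: ub_le_sup; first by exists (g x).
by exists (w x) => //; rewrite fE subrr q0 mul0r subr0.
Qed.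

Lemma strongly_concave_quadratic : strongly_concave_y mu f.
Proof.
move=> x y y' t /andP[t0 t1]; rewrite !fE.
have -> : t *: y + (1 - t) *: y' - w x =
    t *: (y - w x) + (1 - t) *: (y' - w x).
  by rewrite !scalerBr addrACA -opprD -scalerDl [t + _]addrC subrK scale1r.
rewrite q_quad opprB addrA subrK.
have := q_ge (y - y'); have : 0 <= t * (1 - t) by rewrite mulr_ge0 // subr_ge0.
move=> t2 qg; have := ler_wpM2l t2 qg.
by lra.
Qed.

End Quadratic.

Lemma coef_comb n (a b : Rr) (y y' : 'rV[Rr]_n) p :
  coef (a *: y + b *: y') p = a * coef y p + b * coef y' p.
Proof. by rewrite coefD !coefZ. Qed.

Lemma sumsq_ge0 (F : nat -> Rr) a b : 0 <= \sum_(a <= k < b) F k ^+ 2.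
Proof. by apply: sumr_ge0 => k _; exact: sqr_ge0. Qed.

(** * Links between consecutive sites *)

Section Link.
Variable m : nat.
Hypothesis m_gt0 : (0 < m)%N.
Implicit Types (z w : nat -> Rr).

Definition link z : Rr :=
  m%:R^-1 * (z 0%N ^+ 2 + z m ^+ 2) + \sum_(0 <= k < m) (z k.+1 - z k) ^+ 2.

Let m0 : (m%:R : Rr) != 0. Proof. by rewrite pnatr_eq0 -lt0n. Qed.
Let mp : 0 < (m%:R : Rr). Proof. by rewrite ltr0n. Qed.

(** Weighted Cauchy-Schwarz on [z k = z 0 + sum of increments], with weight [m] for [z 0] and 1 for
    each increment, gives [z k ^+ 2 <= (m + k) * link z]; the sum has [m + 1 <= 2 m] terms with
    [m + k <= 2 m]. *)
Lemma link_coercive z : \sum_(0 <= k < m.+1) z k ^+ 2 <= 4 * m%:R ^+ 2 * link z.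
Proof.
have zk k : z k ^+ 2 <= (m + k)%:R *
    (m%:R^-1 * z 0%N ^+ 2 + \sum_(0 <= j < k) (z j.+1 - z j) ^+ 2).
  elim: k => [|k IH]; first by rewrite big_nil addr0 addn0 mulVKf.
  rewrite big_nat_recr //= addnS; set n := (m + k)%N in IH *.
  have n0 : 0 < (n%:R : Rr) by rewrite ltr0n addn_gt0 m_gt0.
  set E := _ + \sum_(0 <= j < k) _ in IH; set d := z k.+1 - z k.
  rewrite addrA -/E -natr1.
  have -> : z k.+1 = z k + d by rewrite /d addrC subrK.
  have zE : z k ^+ 2 / n%:R <= E by rewrite ler_pdivrMr // mulrC.
  rewrite -subr_ge0.
  have -> : (n%:R + 1) * (E + d ^+ 2) - (z k + d) ^+ 2 =
    (n%:R + 1) * (E - z k ^+ 2 / n%:R) + (z k - n%:R * d) ^+ 2 / n%:R.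
    by field; rewrite gt_eqF.
  apply: addr_ge0; last by rewrite divr_ge0 ?sqr_ge0 // ltW.
  by rewrite mulr_ge0 ?subr_ge0 // addr_ge0 // ltW.
have bound k : (k <= m)%N -> z k ^+ 2 <= 2 * m%:R * link z.
  move=> km; apply: (le_trans (zk k)); apply: ler_pM => //.
  - by rewrite addr_ge0 ?sumsq_ge0 // mulr_ge0 ?sqr_ge0 // invr_ge0 ltW.
  - by rewrite -natrM ler_nat mul2n -addnn leq_add2l.
  rewrite /link mulrDr -addrA lerD2l [X in _ <= _ + X](big_cat_nat (leq0n k) km) /=.
  by rewrite addrCA lerDl addr_ge0 ?sumsq_ge0 // mulr_ge0 ?sqr_ge0 // invr_ge0 ltW.
have l0 : 0 <= link z.
  rewrite addr_ge0 ?sumsq_ge0 // mulr_ge0 ?invr_ge0 ?(ltW mp) //.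
  by rewrite addr_ge0 ?sqr_ge0.
apply: (@le_trans _ _ (\sum_(0 <= k < m.+1) (2 * m%:R * link z))).
  by apply: ler_sum_nat => k /andP[_ km]; apply: bound.
rewrite sumr_const_nat subn0 -[leLHS]mulr_natl mulrA ler_wpM2r // -natr1.
have m1 : 1 <= (m%:R : Rr) by rewrite ler1n.
by nra.
Qed.

Lemma eq_link z z' : (forall k, (k <= m)%N -> z k = z' k) -> link z = link z'.
Proof.
move=> zz'; rewrite /link !zz' //; congr (_ + _).
by apply: eq_big_nat => k /andP[_ km]; rewrite !zz' // ltnW.
Qed.

Variable sg : Rr.
Hypothesis sgE : sg ^+ 2 = 3 / m%:R.

Definition link_argmax (a b : Rr) (k : nat) : Rr :=
  sg / 3 * (a * (2 * m%:R - k%:R) - b * (m%:R + k%:R)).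

(** Completing the square: the path linearly coupled to [a] and [b] has maximum
    [a ^+ 2 + b ^+ 2 - a * b]. The value of [sg ^+ 2] normalises the product term. *)
Lemma link_maxE z a b : - link (fun k => z k - link_argmax a b k) / 2 =
  - link z / 2 + sg * (a * z 0%N - b * z m) - (a ^+ 2 + b ^+ 2) + a * b.
Proof.
(* The constant increment of the affine maximiser, which makes the cross terms telescope. *)
pose d := - sg / 3 * (a + b).
have tel : \sum_(0 <= k < m) (z k.+1 - link_argmax a b k.+1 - (z k - link_argmax a b k)) ^+ 2
   = \sum_(0 <= k < m) (z k.+1 - z k) ^+ 2 - 2 * d * (z m - z 0%N) + m%:R * d ^+ 2.
  elim: m => [|n IH]; first by rewrite !big_nil subrr mulr0 mul0r subr0 addr0.
  rewrite !big_nat_recr //= IH /link_argmax /d -!natr1.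
  by field.
rewrite /link tel.
have -> : m%:R * d ^+ 2 = (a + b) ^+ 2 / 3.
  by rewrite /d !exprMn sqrrN sgE exprVn; field.
have e0 : (z 0%N - link_argmax a b 0) ^+ 2 = z 0%N ^+ 2 -
    2 * z 0%N * sg / 3 * m%:R * (2 * a - b) + m%:R * (2 * a - b) ^+ 2 / 3.
  rewrite sqrrB {2}/link_argmax !exprMn sgE /link_argmax; field.
  exact: m0.
have em : (z m - link_argmax a b m) ^+ 2 = z m ^+ 2 -
    2 * z m * sg / 3 * m%:R * (a - 2 * b) + m%:R * (a - 2 * b) ^+ 2 / 3.
  rewrite sqrrB {2}/link_argmax !exprMn sgE /link_argmax; field.
  exact: m0.
by rewrite e0 em /d; field; exact: m0.
Qed.

End Link.

(** * The hard saddle functions *)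

Section Instance.
Variables (lam a s : Rr) (T : nat).
Hypotheses (lam_gt0 : 0 < lam) (a_gt0 : 0 < a) (a_le1 : a <= 1) (s_gt0 : 0 < s).

Definition is_first (i : nat) : Rr := (i == 0)%N%:R.

(* [eps = 1] gives the sites of the primal chain; maximising over the links
   turns [eps = - 1] into [eps = 1]. *)
Definition site (eps : Rr) (i : nat) (u : Rr) : Rr :=
  lam * (is_first i * a / 2 * (u - s) ^+ 2 + eps * (1 - is_first i / 2) * u ^+ 2
         + a ^+ 2 * s ^+ 2 * Ups (u / s)).

Definition dsite (eps : Rr) (i : nat) (u : Rr) : Rr :=
  lam * (is_first i * a * (u - s) + eps * (2 - is_first i) * u + a ^+ 2 * s * dUps (u / s)).

Definition ddsite (eps : Rr) (i : nat) (u : Rr) : Rr :=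
  lam * (is_first i * a + eps * (2 - is_first i) + a ^+ 2 * ddUps (u / s)).

Lemma is_first01 i : 0 <= is_first i <= 1.
Proof. by rewrite /is_first; case: (i == 0)%N; rewrite /= ?lexx ?ler01. Qed.

Lemma is_derive_rescaled (g : Rr -> Rr) (dg : Rr) (u : Rr^o) :
  is_derive (u / s : Rr^o) 1 (g : Rr^o -> Rr^o) dg ->
  is_derive u 1 (fun v : Rr^o => g (v / s) : Rr^o) (dg / s).
Proof.
move=> dgu.
have d1 : is_diff u (fun v : Rr^o => v / s : Rr^o) (fun v : Rr^o => v / s : Rr^o).
  have -> : (fun v : Rr^o => v / s : Rr^o) = ( *:%R s^-1 : Rr^o -> Rr^o).
    by apply/funext => v; rewrite /GRing.scale /= mulrC.
  exact: is_diff_scaler.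
have [dp dv] := is_diff_comp d1 (is_diff_derive1 dgu).
apply: DeriveDef; first exact: diff_derivable.
by rewrite deriveE // dv /= mul1r.
Qed.

Lemma is_derive_site eps i (u : Rr^o) :
  is_derive u 1 (site eps i : Rr^o -> Rr^o) (dsite eps i u).
Proof.
have dU := is_derive_rescaled (is_derive_Ups (u / s : Rr)).
rewrite /site; apply: is_derive_eq; rewrite /GRing.scale /= /dsite.
by field; rewrite gt_eqF.
Qed.

Lemma is_derive_dsite eps i (u : Rr^o) :
  is_derive u 1 (dsite eps i : Rr^o -> Rr^o) (ddsite eps i u).
Proof.
have dU := is_derive_rescaled (is_derive_dUps (u / s : Rr)).
rewrite /dsite; apply: is_derive_eq; rewrite /GRing.scale /= /ddsite.
by field; rewrite gt_eqF.
Qed.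

Lemma dsite_lip eps i u u' : `|eps| <= 1 :> Rr ->
  `|dsite eps i u - dsite eps i u'| <= 16 * lam * `|u - u'|.
Proof.
move=> e1.
have [h0 h1] := andP (is_first01 i).
have vl := dUps_lip (u / s) (u' / s).
rewrite -mulrBl normrM [`|s^-1|]gtr0_norm ?invr_gt0 // in vl.
have -> : dsite eps i u - dsite eps i u' =
  lam * ((is_first i * a + eps * (2 - is_first i)) * (u - u') +
   a ^+ 2 * (s * (dUps (u / s) - dUps (u' / s)))) by rewrite /dsite; ring.
rewrite normrM gtr0_norm // [leRHS]mulrAC [leRHS]mulrC ler_pM2l //.
(* 3 bounds the quadratic part, 13 is the constant of [dUps]; the two factors [s] cancel and
   [a ^+ 2 <= 1]. *)
have -> : 16 * `|u - u'| = 3 * `|u - u'| + 13 * `|u - u'| by ring.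
apply: ler_normD_trans; rewrite normrM.
  rewrite ler_wpM2r // (_ : (3 : Rr) = 1 + 2); last by ring.
  apply: ler_normD_trans; rewrite normrM.
    by rewrite mulr_ile1 // ger0_norm // ltW.
  by rewrite -[leRHS]mul1r ler_pM // ger0_norm; lra.
rewrite -[leRHS]mul1r ler_pM //.
  by rewrite ger0_norm ?sqr_ge0 // expr_le1 // ltW.
rewrite normrM gtr0_norm // mulrC -ler_pdivlMr // -mulrA.
exact: vl.
Qed.

(** Quadratic terms drop out of the difference, so only the well, with its small factor
    [a ^+ 2 / s], is left. *)
Lemma ddsite_lip eps i u u' :
  `|ddsite eps i u - ddsite eps i u'| <= lam * a ^+ 2 * 72 / s * `|u - u'|.
Proof.
have vl := ddUps_lip (u / s) (u' / s).
have -> : ddsite eps i u - ddsite eps i u' =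
  lam * a ^+ 2 * (ddUps (u / s) - ddUps (u' / s)) by rewrite /ddsite; ring.
have la : 0 < lam * a ^+ 2 by rewrite mulr_gt0 // exprn_gt0.
rewrite -mulrBl normrM [`|s^-1|]gtr0_norm ?invr_gt0 // in vl.
rewrite normrM gtr0_norm //.
have -> : lam * a ^+ 2 * 72 / s * `|u - u'| = lam * a ^+ 2 * (72 * (`|u - u'| / s)).
  by ring.
by rewrite ler_pM2l.
Qed.

Lemma dsite0 eps i : (0 < i)%N -> dsite eps i 0 = 0.
Proof.
by case: i => // i _; rewrite /dsite /is_first /= [0 / s]mul0r dUps0; ring.
Qed.

Section Reduced.
Variable X : nat -> Rr.

(** The coefficient 3/2 is the value [Ups 0 = 1/2] plus the lower bound [Ups >= - 1]. *)
Lemma site_gap : (0 < T)%N -> X T = 0 ->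
  chain T (site 1) (fun=> - lam) (fun=> 0) - chain T (site 1) (fun=> - lam) X
  <= lam * s ^+ 2 * (a / 2 + 3 / 2 * a ^+ 2 * T%:R).
Proof.
move=> T0 XT.
have c0 : chain T (site 1) (fun=> - lam) (fun=> 0) =
    lam * s ^+ 2 * (a / 2 + a ^+ 2 * T%:R / 2).
  rewrite /chain; case: T T0 {XT} => // t _; elim: t => [|t IH].
    by rewrite big_nat1 /site /is_first /= [0 / s]mul0r Ups0; field.
  by rewrite big_nat_recr //= IH /site /is_first /= [0 / s]mul0r Ups0 -!natr1; field.
(* Squares of differences are dropped; the half square left at the right end makes the induction
   work and is 0 for [X T]. *)
have cX : lam * (- a ^+ 2 * s ^+ 2 * T%:R - X T ^+ 2 / 2) <=
    chain T (site 1) (fun=> - lam) X.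
  have U i : a ^+ 2 * s ^+ 2 * - 1 <= a ^+ 2 * s ^+ 2 * Ups (X i / s).
    by apply: ler_wpM2l; [rewrite mulr_ge0 ?sqr_ge0 | exact: Ups_ge].
  rewrite /chain; case: T T0 {XT c0} => // t _; elim: t => [|t IH].
    rewrite big_nat1 /site /is_first /=.
    have -> : - lam * (X 0%N * X 1%N) = lam * - (X 0%N * X 1%N) by ring.
    rewrite -mulrDr ler_pM2l // -subr_ge0; have := U 0%N.
    have : 0 <= 1 * a / 2 * (X 0%N - s) ^+ 2.
      by rewrite mulr_ge0 ?sqr_ge0 // mul1r divr_ge0 // ltW.
    have := sqr_ge0 (X 0%N - X 1%N); rewrite sqrrB; lra.
  rewrite big_nat_recr //=; move: IH; set S := \sum_(0 <= i < t.+1) _ => IH.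
  have -> : site 1 t.+1 (X t.+1) + - lam * (X t.+1 * X t.+2) =
     lam * (X t.+1 ^+ 2 + a ^+ 2 * s ^+ 2 * Ups (X t.+1 / s) - X t.+1 * X t.+2).
    by rewrite /site /is_first /=; field.
  have key : lam * (- a ^+ 2 * s ^+ 2 * t.+2%:R - X t.+2 ^+ 2 / 2 -
      (- a ^+ 2 * s ^+ 2 * t.+1%:R - X t.+1 ^+ 2 / 2)) <=
     lam * (X t.+1 ^+ 2 + a ^+ 2 * s ^+ 2 * Ups (X t.+1 / s) - X t.+1 * X t.+2).
    rewrite ler_pM2l // -[in t.+2%:R]natr1; have := U t.+1.
    by have := sqr_ge0 (X t.+1 - X t.+2); rewrite sqrrB; lra.
  by move: key; rewrite mulrBr; lra.
rewrite XT expr0n /= mul0r subr0 in cX.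
rewrite c0; move: cX; lra.
Qed.

Lemma chain_grad_resid i : chain_grad (dsite 1) (fun=> - lam) X i =
  lam * s * resid a (fun j => X j / s) i.
Proof.
rewrite /chain_grad /resid /slope /dsite /is_first; case: i => [|i] /=.
  by field; rewrite gt_eqF.
by field; rewrite gt_eqF.
Qed.

(** The bound starts at [T.-1] because [resid] at index [T] contains [X T.-1], while the gradient
    stops at [T.-1]. With [X T.-1 = 0] all later residuals vanish. *)
Lemma site_grad_lower_bound : (0 < T)%N -> (forall i, (T.-1 <= i)%N -> X i = 0) ->
  lam ^+ 2 * s ^+ 2 * a ^+ 3 <=
  256 * 256 * \sum_(0 <= i < T) chain_grad (dsite 1) (fun=> - lam) X i ^+ 2.
Proof.
move=> T0 XT; pose Y j := X j / s.
under eq_bigr do rewrite chain_grad_resid -/Y exprMn.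
rewrite -mulr_sumr exprMn [leRHS]mulrCA ler_pM2l ?mulr_gt0 ?exprn_gt0 //.
apply: (@resid_lower_bound _ a Y T.-1) => //.
  by move=> i /XT Xi; rewrite /Y Xi mul0r.
move=> n; have [nT|/ltnW Tn] := leqP n T.
  rewrite [leRHS](big_cat_nat (leq0n n) nT) lerDl.
  exact: sumsq_ge0.
have Y0 j : (T.-1 <= j)%N -> Y j = 0 by move=> /XT Xi; rewrite /Y Xi mul0r.
have tail : \sum_(T <= i < n) resid a Y i ^+ 2 = 0.
  rewrite big_nat big1 // => i /andP[Ti _].
  case: i Ti => [|i] Ti; first by move: T0; rewrite ltnNge Ti.
  have Tpi : (T.-1 <= i)%N by rewrite -ltnS prednK.
  by rewrite /resid /slope !Y0 ?leqW // dUps0; ring.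
by rewrite (big_cat_nat (leq0n T) Tn) /= tail addr0.
Qed.

End Reduced.

(** [P] is the number of queries per site. The gradient bound is squared to avoid the power
    [a^(3/2)]. *)
Definition hard_function (mu : Rr) (P d e : nat) (f : 'rV[Rr]_d -> 'rV[Rr]_e -> Rr) :=
  smooth (29 * lam) f /\ strongly_concave_y mu f /\
  hessian_lipschitz (lam * a ^+ 2 * 72 / s) (Phi f) /\
  (forall x, Phi f 0 - Phi f x <= lam * s ^+ 2 * (a / 2 + 3 / 2 * a ^+ 2 * T%:R)) /\
  forall (xs : nat -> 'rV[Rr]_d) (ys : nat -> 'rV[Rr]_e),
    first_order_iterates f xs ys ->
    forall t : nat, (t <= P * T.-1)%N ->
      lam ^+ 2 * s ^+ 2 * a ^+ 3 <= 256 * 256 * enorm (grad (Phi f) (xs t)) ^+ 2.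

(** Common to both constructions: a nearest-neighbour saddle that is the spaced chain minus a
    coercive square centred at [w x] has the chain as its primal function. *)
Lemma hard_instance (P : nat) (h dh : nat -> Rr -> Rr) (c : nat -> Rr) (mu : Rr)
    (w : 'rV[Rr]_(P * T) -> 'rV[Rr]_(P * T)) (q : 'rV[Rr]_(P * T) -> Rr) :
  (0 < P)%N -> (0 < T)%N -> 0 <= mu <= 29 * lam ->
  (forall p (u : Rr^o), is_derive u 1 (h p : Rr^o -> Rr^o) (dh p u)) ->
  (forall p u u', `|dh p u - dh p u'| <= 16 * lam * `|u - u'|) ->
  (forall p, `|c p| <= 2 * lam) ->
  (forall p, (0 < p)%N -> dh p 0 = 0) ->
  (forall y, mu * enorm y ^+ 2 <= q y) -> is_quadratic q ->
  (forall x y, saddle (fun p => (P %| p)%N) h c mu x y =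
     spaced_chain (P := P) (T := T) (site 1) (fun=> - lam) x - q (y - w x) / 2) ->
  exists (d e : nat) (f : 'rV[Rr]_d -> 'rV[Rr]_e -> Rr), hard_function mu P f.
Proof.
move=> P0 T0 mu_l dhE dhl cl dh0 q_ge q_quad fE.
have [mu0 _] := andP mu_l.
exists (P * T)%N, (P * T)%N, (saddle (fun p => (P %| p)%N) h c mu).
have PhiE := Phi_quadratic mu0 fE q_ge q_quad.
split.
  apply: (saddle_smooth _ _ dhE dhl cl) => //.
  (* 3 * (16^2 + 2 * 2^2) = 792 is at most 29^2 = 841. *)
  by rewrite !exprMn; have := sqr_ge0 lam; lra.
split; first exact: (strongly_concave_quadratic fE q_ge q_quad).
rewrite PhiE; split.
  by apply: (spaced_chain_hessian_lipschitz _ _ P0 (is_derive_site 1) (is_derive_dsite 1)) => p u u';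
    exact: ddsite_lip.
have spN x : spaced (P := P) (T := T) x T = 0 by rewrite /spaced coef_out.
split.
  move=> x; have := site_gap T0 (spN x).
  rewrite /spaced_chain (_ : spaced 0 = fun=> 0) //.
  by apply/funext => i; rewrite /spaced coef0.
move=> xs ys it t tPT.
rewrite (enorm_grad_spaced _ P0 (is_derive_site 1)).
apply: site_grad_lower_bound => // i Ti.
(* Site [i] sits at position [P * i >= P * T.-1 >= t], hence is still undiscovered. *)
have := saddle_zero_chain dhE dh0 it (leq_trans tPT (leq_mul (leqnn P) Ti)).
by rewrite /zsel dvdn_mulr.
Qed.

End Instance.

Lemma big_nat_delta n (F : nat -> Rr) j : (j < n)%N ->
  \sum_(0 <= k < n) (k == j)%:R * F k = F j.
Proof.
move=> jn; rewrite -[RHS](big_delta F (Ordinal jn)).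
by apply: eq_bigr => k _; rewrite mulrC.
Qed.

(** * The unlinked and the linked instance *)

Section Instances.
Variables (lam a s mu : Rr) (T : nat).
Hypotheses (lam_gt0 : 0 < lam) (a_gt0 : 0 < a) (a_le1 : a <= 1) (s_gt0 : 0 < s).
Hypotheses (T_gt0 : (0 < T)%N) (mu_ge0 : 0 <= mu).

Lemma direct_instance : mu <= 29 * lam ->
  exists d e (f : 'rV[Rr]_d -> 'rV[Rr]_e -> Rr), hard_function lam a s T mu 1 f.
Proof.
move=> mul.
have mu_l : 0 <= mu <= 29 * lam by rewrite mu_ge0.
have hl p u u' : `|dsite lam a s 1 p u - dsite lam a s 1 p u'| <= 16 * lam * `|u - u'|.
  by apply: dsite_lip => //; rewrite normr1.
have cl (p : nat) : `|- lam| <= 2 * lam by rewrite normrN gtr0_norm //; lra.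
pose q (y : 'rV[Rr]_(1 * T)) := mu * \sum_(0 <= p < 1 * T) coef y p ^+ 2.
have q_ge y : mu * enorm y ^+ 2 <= q y by rewrite enorm_sqr.
have q_quad : is_quadratic q.
  apply: is_quadraticZ; apply: is_quadratic_sum => i; apply: is_quadratic_sqr => *.
  exact: coef_comb.
apply: (hard_instance lam_gt0 a_gt0 a_le1 s_gt0 (ltn0Sn 0) T_gt0 mu_l
  (is_derive_site lam a s_gt0 1) hl cl (@dsite0 lam a s 1) q_ge q_quad (w := fun=> 0)).
move=> x y; rewrite /saddle /spaced_chain subr0; congr (_ + _).
  have ch h c X : chain T h c X = chain (1 * T) h c X by rewrite mul1n.
  rewrite [RHS]ch; apply: eq_bigr => p _.
  by rewrite /zsel /spaced [(1 * p)%N]mul1n [(1 * p.+1)%N]mul1n !dvd1n.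
rewrite [RHS](_ : _ = - (mu / 2) * \sum_(0 <= p < 1 * T) coef y p ^+ 2); last first.
  by rewrite /q; ring.
rewrite /chain mulr_sumr; apply: eq_bigr => p _.
by rewrite /dummy dvd1n /= mul0r addr0; ring.
Qed.

Section Linked.
Variable m : nat.
Hypotheses (m_gt0 : (0 < m)%N) (mu_small : 4 * m%:R ^+ 2 * mu <= lam).
Local Notation P := m.+2.

Definition coupling : Rr := Num.sqrt (3 / m%:R).

Lemma coupling_sqr : coupling ^+ 2 = 3 / m%:R.
Proof. by rewrite sqr_sqrtr // divr_ge0. Qed.

Lemma coupling_le2 : coupling <= 2.
Proof.
rewrite -ler_sqr ?nnegrE ?sqrtr_ge0 // coupling_sqr ler_pdivrMr ?ltr0n //.
have : 1 <= (m%:R : Rr) by rewrite ler1n.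
by lra.
Qed.

(** The coefficient of [z k ^+ 2] in [link]: 2 inside the path, [1 + 1 / m] at its ends. *)
Definition link_diag (k : nat) : Rr :=
  2 + (m%:R^-1 - 1) * ((k == 0)%N%:R + (k == m)%:R).

Lemma link_diag_bounds k : 0 <= link_diag k <= 2.
Proof.
have m1 : 1 <= (m%:R : Rr) by rewrite ler1n.
have i0 : 0 < (m%:R^-1 : Rr) by rewrite invr_gt0 ltr0n.
have i1 : (m%:R^-1 : Rr) <= 1 by rewrite invf_le1 // ltr0n.
rewrite /link_diag; case: eqP => [->|_] /=.
  by rewrite ltn_eqF //=; lra.
by case: eqP => _ /=; lra.
Qed.

Lemma link_expand z : - link m z / 2 =
  \sum_(0 <= k < m.+1) - (link_diag k * z k ^+ 2) / 2 + \sum_(0 <= k < m) z k * z k.+1.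
Proof.
have sq n : \sum_(0 <= k < n) (z k.+1 - z k) ^+ 2 = 2 * (\sum_(0 <= k < n.+1) z k ^+ 2)
    - z 0%N ^+ 2 - z n ^+ 2 - 2 * \sum_(0 <= k < n) z k * z k.+1.
  elim: n => [|n IH]; first by rewrite !big_nil big_nat1; ring.
  by rewrite big_nat_recr //= IH [in RHS]big_nat_recr //=
    [\sum_(0 <= k < n.+1) z k * z k.+1]big_nat_recr //=; ring.
have dg : \sum_(0 <= k < m.+1) - (link_diag k * z k ^+ 2) / 2 =
    - (\sum_(0 <= k < m.+1) z k ^+ 2) - (m%:R^-1 - 1) * (z 0%N ^+ 2 + z m ^+ 2) / 2.
  rewrite -(big_nat_delta (fun k => z k ^+ 2) (ltn0Sn m)).
  rewrite -[z m ^+ 2](big_nat_delta (fun k => z k ^+ 2) (ltnSn m)).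
  rewrite -big_split /= mulr_sumr mulr_suml -!sumrN -big_split /=.
  by apply: eq_bigr => k _; rewrite /link_diag; field; rewrite pnatr_eq0 -lt0n.
by rewrite /link sq dg; field; rewrite pnatr_eq0 -lt0n.
Qed.

(** In each period residue 0 is the site and residues 1 to [m + 1] are the path; [k] is the path
    index, hence the shift by one. *)
Definition linked_h p (u : Rr) : Rr :=
  if (p %% P)%N is k.+1 then - (lam / 2) * link_diag k * u ^+ 2
  else site lam a s (- 1) (p %/ P)%N u.

Definition linked_dh p (u : Rr) : Rr :=
  if (p %% P)%N is k.+1 then - lam * link_diag k * u
  else dsite lam a s (- 1) (p %/ P)%N u.

Definition linked_c p : Rr :=
  if (p %% P)%N is k.+1 then (if k == m then - lam * coupling else lam)
  else lam * coupling.

Definition linked_q (y : 'rV[Rr]_(P * T)) : Rr :=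
  \sum_(0 <= i < T) (mu * coef y (P * i) ^+ 2 +
    lam * link m (fun k => coef y (P * i + k.+1))).

Definition linked_argmax (x : 'rV[Rr]_(P * T)) : 'rV[Rr]_(P * T) :=
  \row_p (if (p %% P)%N is k.+1 then
    link_argmax m coupling (spaced x (p %/ P)) (spaced x (p %/ P).+1) k else 0).

Let modP i k : (k < P)%N -> ((P * i + k) %% P = k)%N.
Proof. by move=> kP; rewrite mulnC modnMDl modn_small. Qed.

Let divP i k : (k < P)%N -> ((P * i + k) %/ P = i)%N.
Proof. by move=> kP; rewrite mulnC divnMDl // divn_small // addn0. Qed.

Let ltP i k : (i < T)%N -> (k < P)%N -> (P * i + k < P * T)%N.
Proof.
move=> iT kP; apply: (@leq_trans (P * i.+1)%N); first by rewrite mulnS addnC ltn_add2r.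
by rewrite leq_pmul2l.
Qed.

(** [link_expand] turns the path terms into [link], and [link_maxE] completes the square with the
    two end couplings. *)
Lemma linked_block (x y : 'rV[Rr]_(P * T)) i (b := spaced x i) (b' := spaced x i.+1)
    (z := zsel (fun p => (P %| p)%N) x y) :
  \sum_(0 <= k < P) (linked_h (P * i + k) (z (P * i + k)%N)
     + linked_c (P * i + k) * (z (P * i + k)%N * z (P * i + k).+1)) =
  site lam a s (- 1) i b + lam * (b ^+ 2 + b' ^+ 2) - lam * (b * b')
  - lam * link m (fun k => coef y (P * i + k.+1) - link_argmax m coupling b b' k) / 2.
Proof.
have zb : z (P * i)%N = b by rewrite /z /zsel dvdn_mulr.
have zy k : (k <= m)%N -> z (P * i + k.+1)%N = coef y (P * i + k.+1).
  by move=> km; rewrite /z /zsel dvdn_addr ?dvdn_mulr // gtnNdvd.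
have zb' : z (P * i + m.+2)%N = b'.
  by rewrite /z /zsel addnC -mulnS dvdn_mulr.
rewrite big_nat_recl // addn0 {1}/linked_h {1}/linked_c -[(P * i)%N]addn0 modP // divP //.
have z1 : z (P * i).+1 = coef y (P * i + 1) by rewrite -addn1 zy.
rewrite addn0 zb z1.
rewrite big_nat_recr //= {2}/linked_h {2}/linked_c modP // eqxx -addnS zb' zy //.
rewrite (eq_big_nat _ _ (F2 := fun k => - (lam / 2) * link_diag k * coef y (P * i + k.+1) ^+ 2 +
   lam * (coef y (P * i + k.+1) * coef y (P * i + k.+2)))); last first.
  move=> k /andP[_ km]; rewrite /linked_h /linked_c modP; last by rewrite !ltnS ltnW.
  by rewrite ltn_eqF // -addnS !zy // ltnW.
pose Y k := coef y (P * i + k.+1).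
have H := link_maxE m_gt0 coupling_sqr Y b b'.
have E := link_expand Y; rewrite big_nat_recr //= in E.
have -> : \sum_(0 <= k < m) (- (lam / 2) * link_diag k * coef y (P * i + k.+1) ^+ 2 +
    lam * (coef y (P * i + k.+1) * coef y (P * i + k.+2))) =
  lam * (\sum_(0 <= k < m) - (link_diag k * Y k ^+ 2) / 2 +
         \sum_(0 <= k < m) Y k * Y k.+1).
  rewrite -big_split mulr_sumr /=; apply: eq_bigr => k _.
  by rewrite /Y; field.
rewrite -[coef y (P * i + 1)]/(Y 0%N) -[coef y (P * i + m.+1)]/(Y m).
rewrite -[link m _]/(link m (fun k => Y k - link_argmax m coupling b b' k)).
set L1 := link m (fun k => Y k - _) in H *.
have -> : lam * L1 / 2 = - lam * (- L1 / 2) by field.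
by rewrite H E; field.
Qed.

(** An inner site gets [lam * X i ^+ 2] from each of its two links, turning coefficient - 1 into 1;
    the first site has one link, turning - 1/2 into 1/2. *)
Lemma linked_chain_sum (X : nat -> Rr) : X T = 0 ->
  \sum_(0 <= i < T) (site lam a s (- 1) i (X i) + lam * (X i ^+ 2 + X i.+1 ^+ 2)
     - lam * (X i * X i.+1)) = chain T (site lam a s 1) (fun=> - lam) X.
Proof.
move=> XT; rewrite /chain; apply/eqP; rewrite -subr_eq0 -sumrB.
have XT2 : lam * X T ^+ 2 = 0 by rewrite XT expr0n mulr0.
(* For the induction the difference of both sides is kept as the surplus [lam * X T ^+ 2] of the
   last link. *)
rewrite -[X in _ == X]XT2; case: T T_gt0 {XT XT2} => // t _; elim: t => [|t IH].
  by rewrite big_nat1 /site /is_first /=; apply/eqP; field.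
rewrite big_nat_recr //= (eqP IH) /site /is_first /=; by apply/eqP; field.
Qed.

Lemma linked_saddleE x y :
  saddle (fun p => (P %| p)%N) linked_h linked_c mu x y =
  spaced_chain (P := P) (T := T) (site lam a s 1) (fun=> - lam) x
  - linked_q (y - linked_argmax x) / 2.
Proof.
have XT : spaced (P := P) (T := T) x T = 0 by rewrite /spaced coef_out.
rewrite /saddle /spaced_chain -(linked_chain_sum XT) /chain !big_blocks.
rewrite /linked_q mulr_suml -!sumrN -!big_split /=; apply: eq_big_nat => i /andP[_ iT].
rewrite linked_block.
have -> : \sum_(0 <= k < P) (dummy (fun p => (P %| p)%N) mu (P * i + k) (coef y (P * i + k)%N)
    + 0 * (coef y (P * i + k)%N * coef y (P * i + k).+1)) = - (mu / 2) * coef y (P * i) ^+ 2.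
  rewrite big_ltn // addn0 big_nat big1 ?addr0 => [|k /andP[k0 kP]].
    by rewrite /dummy dvdn_mulr // mul1r mul0r addr0.
  by rewrite /dummy dvdn_addr ?dvdn_mulr // gtnNdvd // !mul0r mulr0 addr0.
have w0 : coef (linked_argmax x) (P * i) = 0.
  have pN := @ltP i 0 iT (ltn0Sn _); rewrite -[(P * i)%N]addn0.
  by rewrite -[(P * i + 0)%N]/(val (Ordinal pN)) coef_ord mxE /= modP.
have wk k : (k <= m)%N -> coef (linked_argmax x) (P * i + k.+1) =
    link_argmax m coupling (spaced x i) (spaced x i.+1) k.
  move=> km; have pN := @ltP i k.+1 iT km.
  by rewrite -[(P * i + k.+1)%N]/(val (Ordinal pN)) coef_ord mxE /= modP // divP.
rewrite coefB w0 subr0 (eq_link (z' := fun k => coef y (P * i + k.+1) -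
   link_argmax m coupling (spaced x i) (spaced x i.+1) k)); last first.
  by move=> k km; rewrite coefB wk.
by field.
Qed.

(** Coercivity is [lam / (4 m ^+ 2)] on paths, so [mu_small] lets [m] grow up to order
    [sqrt (lam / mu)]. *)
Lemma linked_q_ge y : mu * enorm y ^+ 2 <= linked_q y.
Proof.
rewrite enorm_sqr big_blocks mulr_sumr; apply: ler_sum => i _.
rewrite big_nat_recl // addn0 mulrDr lerD2l.
apply: (le_trans (ler_wpM2l mu_ge0 (link_coercive m_gt0 (fun k => coef y (P * i + k.+1))))).
rewrite mulrA [mu * _]mulrC ler_wpM2r //.
rewrite /link addr_ge0 ?sumsq_ge0 // mulr_ge0 ?invr_ge0 //.
by rewrite addr_ge0 ?sqr_ge0.
Qed.

Lemma linked_q_quadratic : is_quadratic linked_q.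
Proof.
have lc p : is_quadratic (fun y : 'rV[Rr]_(P * T) => coef y p ^+ 2).
  by apply: is_quadratic_sqr => *; exact: coef_comb.
apply: is_quadratic_sum => i; apply: is_quadraticD; first exact: is_quadraticZ.
apply: is_quadraticZ; apply: is_quadraticD; first by apply: is_quadraticZ; exact: is_quadraticD.
apply: is_quadratic_sum => k; apply: is_quadratic_sqr => *; rewrite !coef_comb; ring.
Qed.

Lemma is_derive_linked_h p (u : Rr^o) :
  is_derive u 1 (linked_h p : Rr^o -> Rr^o) (linked_dh p u).
Proof.
rewrite /linked_h /linked_dh; case: (p %% P)%N => [|k]; first exact: is_derive_site.
apply: is_derive_eq; rewrite /GRing.scale /= mulr1.
by field.
Qed.

Lemma linked_dh_lip p u u' : `|linked_dh p u - linked_dh p u'| <= 16 * lam * `|u - u'|.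
Proof.
rewrite /linked_dh; case: (p %% P)%N => [|k].
  by apply: dsite_lip => //; rewrite normrN normr1.
have /andP[d0 d2] := link_diag_bounds k.
rewrite -mulrBr normrM ler_wpM2r //.
rewrite mulNr normrN ger0_norm ?mulr_ge0 ?(ltW lam_gt0) //.
by rewrite mulrC ler_pM2r //; lra.
Qed.

Lemma linked_c_le p : `|linked_c p| <= 2 * lam.
Proof.
have lc : `|lam * coupling| <= 2 * lam.
  by rewrite normrM gtr0_norm // mulrC ger0_norm ?sqrtr_ge0 // ler_pM2r // coupling_le2.
rewrite /linked_c; case: (p %% P)%N => [//|k]; case: ifP => _.
  by rewrite mulNr normrN.
by rewrite gtr0_norm //; have := lam_gt0; lra.
Qed.

Lemma linked_dh0 p : (0 < p)%N -> linked_dh p 0 = 0.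
Proof.
move=> p0; rewrite /linked_dh; case E : (p %% P)%N => [|k]; last by rewrite mulr0.
by rewrite dsite0 // divn_gt0 // dvdn_leq // /dvdn E.
Qed.

Lemma linked_instance :
  exists d e (f : 'rV[Rr]_d -> 'rV[Rr]_e -> Rr), hard_function lam a s T mu P f.
Proof.
have mul : 0 <= mu <= 29 * lam.
  rewrite mu_ge0; have m1 : 1 <= (m%:R : Rr) by rewrite ler1n.
  have m2 : 1 <= (m%:R : Rr) ^+ 2 by rewrite expr_ge1 // (le_trans _ m1).
  by have := ler_wpM2r mu_ge0 m2; have := mu_small; have := lam_gt0; lra.
exact: (hard_instance lam_gt0 a_gt0 a_le1 s_gt0 (ltn0Sn _) T_gt0 mul
  is_derive_linked_h linked_dh_lip linked_c_le linked_dh0 linked_q_ge linked_q_quadratic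
  linked_saddleE).
Qed.

End Linked.
End Instances.

Lemma powR_exprn (x r : Rr) n : 0 <= x -> (powR x r) ^+ n = powR x (r * n%:R).
Proof. by move=> x0; rewrite -powR_mulrn ?powR_ge0 // -powRrM. Qed.

(** [m] is the integer part of [r = sqrt (lam / (4 mu))]. Since [l / mu = 116 r ^+ 2] and 116 <=
    11^2, 11 works in both regimes. *)
Lemma chain_length (l mu lam : Rr) : 0 < mu -> l = 29 * lam -> 0 < lam ->
  (4 * mu <= lam -> exists m : nat, [/\ (0 < m)%N, 4 * m%:R ^+ 2 * mu <= lam &
     Num.sqrt (l / mu) <= 11 * m.+2%:R]) /\
  (lam < 4 * mu -> Num.sqrt (l / mu) <= 11).
Proof.
move=> mu0 -> lam0; split=> [h|h]; last first.
  rewrite -(@ler_sqr _ _ 11) ?nnegrE ?sqrtr_ge0 // sqr_sqrtr; last first.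
    by rewrite divr_ge0 // ?mulr_ge0 // ltW.
  by rewrite ler_pdivrMr //; lra.
set r := Num.sqrt (lam / (4 * mu)).
have r2 : r ^+ 2 = lam / (4 * mu).
  by rewrite sqr_sqrtr // divr_ge0 // ?mulr_ge0 // ltW.
have r0 : 0 <= r by exact: sqrtr_ge0.
have r1 : 1 <= r.
  rewrite -ler_sqr ?nnegrE // r2 expr1n ler_pdivlMr ?mulr_gt0 //; lra.
have /andP[m1 m2] := truncn_itv r0.
set m := Num.truncn r in m1 m2.
have m0 : (0 < m)%N by rewrite -ltnS -(ltr_nat Rr); lra.
exists m; split => //.
  have : m%:R ^+ 2 <= r ^+ 2 by rewrite lerXn2r ?nnegrE.
  by rewrite r2 ler_pdivlMr ?mulr_gt0 //; lra.
rewrite -ler_sqr ?nnegrE ?sqrtr_ge0 ?mulr_ge0 // sqr_sqrtr; last first.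
  by rewrite divr_ge0 // ?mulr_ge0 // ltW.
have -> : 29 * lam / mu = 116 * r ^+ 2 by rewrite r2; field; rewrite gt_eqF.
rewrite exprMn; have : r ^+ 2 <= m.+2%:R ^+ 2.
  by rewrite lerXn2r ?nnegrE // ltW // (lt_trans m2) // ltr_nat.
have := sqr_ge0 r; lra.
Qed.

Lemma expr7_le (x y : Rr) : 0 <= x -> 0 <= y -> x ^+ 7 <= y ^+ 7 -> x <= y.
Proof. by move=> x0 y0; rewrite ler_pXn2r. Qed.

(** * Choice of the scales *)

Section Scales.
Variables (B Delta lam L2 eps : Rr).
Hypotheses (Delta_gt0 : 0 < Delta) (lam_gt0 : 0 < lam) (L2_gt0 : 0 < L2) (eps_gt0 : 0 < eps).
Hypothesis BE : B = 6 * 72 ^+ 2.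

(** The square root of the parameter [a], so that [a^(7/2)] and all other scales are integer powers
    of it. *)
Definition root7 : Rr := powR (4 * L2 * eps / lam ^+ 2) (1 / 7).
(** Chosen so that the Hessian constant [lam * a ^+ 2 * 72 / s] is exactly [L2]. *)
Definition radius : Rr := 72 * lam * root7 ^+ 4 / L2.
Definition decrease : Rr := lam * radius ^+ 2 * root7 ^+ 4.

Lemma root7_exp7 : root7 ^+ 7 = 4 * L2 * eps / lam ^+ 2.
Proof.
have K0 : 0 < 4 * L2 * eps / lam ^+ 2 by rewrite divr_gt0 ?mulr_gt0 ?exprn_gt0.
by rewrite /root7 powR_exprn ?ltW // divfK ?pnatr_eq0 // powRr1 // ltW.
Qed.

Lemma root7_gt0 : 0 < root7.
Proof. by rewrite powR_gt0 // divr_gt0 ?mulr_gt0 ?exprn_gt0. Qed.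

Lemma radius_gt0 : 0 < radius.
Proof. by rewrite /radius divr_gt0 ?mulr_gt0 ?exprn_gt0 ?root7_gt0. Qed.

Lemma decrease_gt0 : 0 < decrease.
Proof.
have r := exprn_gt0 2 radius_gt0; have q := exprn_gt0 4 root7_gt0.
by apply: mulr_gt0 => //; exact: mulr_gt0.
Qed.

Lemma root7_le1 : 4 * L2 * eps <= lam ^+ 2 -> root7 <= 1.
Proof.
move=> h; apply: expr7_le => //; first exact: ltW root7_gt0.
by rewrite root7_exp7 expr1n ler_pdivrMr ?exprn_gt0 // mul1r.
Qed.

(** The factor 4 in [root7] and the 72 in [radius] make the right side [(288 * eps) ^+ 2], and 288 >
    256. *)
Lemma gradient_gt_eps :
  256 * 256 * eps ^+ 2 < lam ^+ 2 * radius ^+ 2 * (root7 ^+ 2) ^+ 3.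
Proof.
have -> : lam ^+ 2 * radius ^+ 2 * (root7 ^+ 2) ^+ 3 =
    (72 * lam ^+ 2 * root7 ^+ 7 / L2) ^+ 2 by rewrite /radius; field; rewrite gt_eqF.
have -> : 72 * lam ^+ 2 * root7 ^+ 7 / L2 = 288 * eps.
  by rewrite root7_exp7; field; rewrite !gt_eqF.
by have : 0 < eps ^+ 2 by [rewrite exprn_gt0]; rewrite exprMn; lra.
Qed.

Lemma initial_gap (l : Rr) : l = 29 * lam ->
  eps ^+ 10 * 4 ^+ 10 * l * B ^+ 9 <= Delta ^+ 7 * L2 ^+ 4 ->
  6 * (lam * radius ^+ 2 * root7 ^+ 2) <= Delta.
Proof.
move=> lE h; apply: expr7_le; [|exact: ltW|].
  have r := exprn_gt0 2 radius_gt0; have q := exprn_gt0 2 root7_gt0.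
  by apply: mulr_ge0 => //; apply: ltW; apply: mulr_gt0 => //; exact: mulr_gt0.
have -> : 6 * (lam * radius ^+ 2 * root7 ^+ 2) = B * lam ^+ 3 * root7 ^+ 10 / L2 ^+ 2.
  by rewrite /radius BE; field; rewrite gt_eqF.
have -> : (B * lam ^+ 3 * root7 ^+ 10 / L2 ^+ 2) ^+ 7 =
    B ^+ 7 * lam ^+ 21 * (root7 ^+ 7) ^+ 10 / L2 ^+ 14.
  by field; rewrite gt_eqF.
rewrite root7_exp7.
have -> : B ^+ 7 * lam ^+ 21 * (4 * L2 * eps / lam ^+ 2) ^+ 10 / L2 ^+ 14 =
    B ^+ 7 * (eps ^+ 10 * 4 ^+ 10 * lam) / L2 ^+ 4.
  by field; rewrite !gt_eqF.
rewrite ler_pdivrMr ?exprn_gt0 //; apply: le_trans h.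
have B1 : 1 <= B by rewrite BE; lra.
have -> : eps ^+ 10 * 4 ^+ 10 * l * B ^+ 9 =
    (eps ^+ 10 * 4 ^+ 10 * lam) * B ^+ 7 * (29 * B ^+ 2) by rewrite lE; ring.
have e10 := exprn_ge0 10 (ltW eps_gt0); have B7 : 0 <= B ^+ 7 by rewrite exprn_ge0 //; lra.
rewrite [leLHS]mulrC; apply: ler_peMr; last by have := exprn_ege1 2 B1; lra.
apply: mulr_ge0 => //; apply: mulr_ge0; last exact: ltW.
by apply: mulr_ge0 => //; rewrite exprn_ge0.
Qed.

(** In the seventh power all of [lam], [L2] and [eps] cancel, leaving a comparison of numbers. *)
Lemma rate_decrease (l : Rr) : l = 29 * lam ->
  decrease * (powR l (3 / 7) * powR L2 (2 / 7) * powR eps (- (12 / 7))) <= B ^+ 2.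
Proof.
move=> lE; have l0 : 0 < l by rewrite lE mulr_gt0.
have B1 : 1 <= B by rewrite BE; lra.
apply: expr7_le; [|by rewrite exprn_ge0 //; lra|].
  apply: mulr_ge0; first exact: ltW decrease_gt0.
  by apply: mulr_ge0; [apply: mulr_ge0|]; exact: powR_ge0.
have e1 : powR l (3 / 7) ^+ 7 = l ^+ 3.
  by rewrite powR_exprn ?ltW // divfK ?pnatr_eq0 // powR_mulrn // ltW.
have e2 : powR L2 (2 / 7) ^+ 7 = L2 ^+ 2.
  by rewrite powR_exprn ?ltW // divfK ?pnatr_eq0 // powR_mulrn // ltW.
have e3 : powR eps (- (12 / 7)) ^+ 7 = (eps ^+ 12)^-1.
  by rewrite powR_exprn ?ltW // mulNr divfK ?pnatr_eq0 // powRN powR_mulrn // ltW.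
move: e1 e2 e3; move: (powR l _) (powR L2 _) (powR eps _) => E1 E2 E3 e1 e2 e3.
have -> : (decrease * (E1 * E2 * E3)) ^+ 7 =
    (72 ^+ 2) ^+ 7 * lam ^+ 21 * (root7 ^+ 7) ^+ 12 / L2 ^+ 14 *
    (E1 ^+ 7 * E2 ^+ 7 * E3 ^+ 7).
  by rewrite /decrease /radius; move: root7 => r; field; rewrite gt_eqF.
rewrite e1 e2 e3 {E1 E2 E3 e1 e2 e3}.
rewrite root7_exp7 lE.
set D := 72 ^+ 2.
have -> : D ^+ 7 * lam ^+ 21 * (4 * L2 * eps / lam ^+ 2) ^+ 12 / L2 ^+ 14 *
   ((29 * lam) ^+ 3 * L2 ^+ 2 / eps ^+ 12) = D ^+ 7 * (4 ^+ 12 * 29 ^+ 3).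
  by field; rewrite !gt_eqF.
have DB : D <= B by rewrite BE /D; lra.
have D0 : 0 <= D by rewrite /D exprn_ge0.
have k1 : 4 ^+ 12 <= B ^+ 3.
  rewrite -[12%N]/(4 * 3)%N exprM lerXn2r ?nnegrE ?exprn_ge0 //; first lra.
  by rewrite BE; lra.
have k2 : 29 ^+ 3 <= B ^+ 3.
  by rewrite lerXn2r ?nnegrE //; [lra | rewrite BE; lra].
rewrite -exprM (_ : 2 * 7 = 7 + (3 + 3) + 1)%N // !exprD expr1 -[leLHS]mulr1.
apply: ler_pM => //; first by rewrite !mulr_ge0 ?exprn_ge0.
apply: ler_pM; rewrite ?mulr_ge0 ?exprn_ge0 //.
  by rewrite lerXn2r ?nnegrE //; lra.
by apply: ler_pM; rewrite ?exprn_ge0.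
Qed.

End Scales.

(** * Assembling the lower bound *)

Lemma hard_function_exists (lam a s mu l : Rr) (T : nat) :
  0 < lam -> 0 < a -> a <= 1 -> 0 < s -> (0 < T)%N -> 0 < mu -> l = 29 * lam ->
  mu <= l ->
  exists P d e (f : 'rV[Rr]_d -> 'rV[Rr]_e -> Rr),
    hard_function lam a s T mu P f /\ Num.sqrt (l / mu) <= 11 * P%:R.
Proof.
move=> lam0 a0 a1 s0 T0 mu0 lE mul.
have [long short] := chain_length mu0 lE lam0.
have [/long [m [m0 m1 m2]]|/short k] := leP (4 * mu) lam.
  have [d [e [f hf]]] := linked_instance lam0 a0 a1 s0 T0 (ltW mu0) m0 m1.
  by exists m.+2, d, e, f.
have [|d [e [f hf]]] := direct_instance lam0 a0 a1 s0 T0 (ltW mu0).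
  by rewrite -lE.
by exists 1%N, d, e, f; split=> //; rewrite mulr1.
Qed.

Lemma hard_function_lower_bound (lam a s mu eps : Rr) (T P d e : nat)
    (f : 'rV[Rr]_d -> 'rV[Rr]_e -> Rr) xs ys t :
  hard_function lam a s T mu P f -> 0 <= eps ->
  256 * 256 * eps ^+ 2 < lam ^+ 2 * s ^+ 2 * a ^+ 3 ->
  first_order_iterates f xs ys -> enorm (grad (Phi f) (xs t)) <= eps ->
  (P * T.-1 < t)%N.
Proof.
move=> [_ [_ [_ [_ lb]]]] eps0 small it ge; rewrite ltnNge; apply/negP => tP.
have := lb _ _ it _ tP.
have : enorm (grad (Phi f) (xs t)) ^+ 2 <= eps ^+ 2.
  by rewrite lerXn2r ?nnegrE ?enorm_ge0.
lra.
Qed.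

Lemma first_condition (l L2 lam eps q : Rr) : 0 < L2 -> 0 < eps -> 841 <= q ->
  l = 29 * lam -> eps <= (1 / 4) * (l / q) ^+ 2 / (L2 / q) ->
  4 * L2 * eps <= lam ^+ 2.
Proof.
move=> L20 eps0 q1 lE; have q0 : 0 < q by lra.
have -> : (1 / 4) * (l / q) ^+ 2 / (L2 / q) = l ^+ 2 / (4 * L2 * q).
  by field; rewrite !gt_eqF.
rewrite ler_pdivlMr ?mulr_gt0 // lE => h.
have : 4 * L2 * eps * 841 <= 4 * L2 * eps * q by rewrite ler_pM2l // !mulr_gt0.
by rewrite exprMn in h; lra.
Qed.

Lemma second_condition (Delta l L2 eps B : Rr) : 0 < Delta -> 0 < l -> 0 < L2 ->
  0 < eps -> 0 < B ->
  eps <= (1/4) * powR Delta (7/10) * powR (l / B ^+ 3) (- (1/10))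
                          * powR (L2 / B ^+ 3) (2/5) ->
  eps ^+ 10 * 4 ^+ 10 * l * B ^+ 9 <= Delta ^+ 7 * L2 ^+ 4.
Proof.
move=> D0 l0 L20 eps0 B0 h.
have q0 : 0 < B ^+ 3 by rewrite exprn_gt0.
have lq0 : 0 < l / B ^+ 3 by rewrite divr_gt0.
have Lq0 : 0 < L2 / B ^+ 3 by rewrite divr_gt0.
have e1 : powR Delta (7 / 10) ^+ 10 = Delta ^+ 7.
  by rewrite powR_exprn ?ltW // divfK ?pnatr_eq0 // powR_mulrn // ltW.
have e2 : powR (l / B ^+ 3) (- (1 / 10)) ^+ 10 = (l / B ^+ 3)^-1.
  by rewrite powR_exprn ?ltW // mulNr divfK ?pnatr_eq0 // powRN powRr1 // ltW.
have e3 : powR (L2 / B ^+ 3) (2 / 5) ^+ 10 = (L2 / B ^+ 3) ^+ 4.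
  rewrite powR_exprn ?ltW // (_ : 2 / 5 * 10 = 4 :> Rr); last by field.
  by rewrite powR_mulrn // ltW.
have := lerXn2r 10 _ _ h; rewrite !nnegrE => /(_ (ltW eps0)) hh.
have {hh} : eps ^+ 10 <= (1 / 4 * Delta `^ (7 / 10) * (l / B ^+ 3) `^ (- (1 / 10)) *
   (L2 / B ^+ 3) `^ (2 / 5)) ^+ 10 by apply: hh; apply: le_trans h; exact: ltW.
move: e1 e2 e3; move: (powR Delta _) (powR _ (- _)) (powR _ (2 / 5)) => E1 E2 E3 e1 e2 e3.
have -> : (1 / 4 * E1 * E2 * E3) ^+ 10 = (E1 ^+ 10 * E2 ^+ 10 * E3 ^+ 10) / 4 ^+ 10 by field.
rewrite e1 e2 e3.
have -> : Delta ^+ 7 * (l / B ^+ 3)^-1 * (L2 / B ^+ 3) ^+ 4 / 4 ^+ 10 =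
   Delta ^+ 7 * L2 ^+ 4 / (4 ^+ 10 * l * B ^+ 9) by field; rewrite !gt_eqF.
by rewrite ler_pdivlMr ?mulr_gt0 ?exprn_gt0 // !mulrA.
Qed.

Theorem theorem2 :
  exists (lb1 lb2 c : Rr), 0 < lb1 /\ 0 < lb2 /\ 0 < c /\
  forall (Delta l L2 mu eps : Rr),
    0 < Delta -> 0 < l -> 0 < L2 -> 0 < mu -> 0 < eps ->
    1 <= l / mu ->
    eps <= Num.min ((1/4) * (l / lb1) ^+ 2 / (L2 / lb2))
                   ((1/4) * powR Delta (7/10) * powR (l / lb1) (- (1/10))
                          * powR (L2 / lb2) (2/5)) ->
    exists (d e : nat) (f : 'rV[Rr]_d -> 'rV[Rr]_e -> Rr),
      smooth l f /\ strongly_concave_y mu f /\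
      hessian_lipschitz L2 (Phi f) /\
      (forall x, Phi f 0 - Phi f x <= Delta) /\
      forall (xs : nat -> 'rV[Rr]_d) (ys : nat -> 'rV[Rr]_e),
        first_order_iterates f xs ys ->
        forall t : nat, enorm (grad (Phi f) (xs t)) <= eps ->
          c * Delta * Num.sqrt (l / mu) * powR l (3/7) * powR L2 (2/7)
            * powR eps (- (12/7)) <= t%:R.
Proof.
have [B BE] : exists B : Rr, B = 6 * 72 ^+ 2 by exists (6 * 72 ^+ 2).
have B29 : 29 <= B by rewrite BE; lra.
have B0 : 0 < B by lra.
(* 132 = 6 * 11 * 2, from [Delta <= 6 M T], [sqrt kappa <= 11 P] and [P T / 2 <= t]; [B ^+ 2] comes
   from [rate]. *)
exists (B ^+ 3), (B ^+ 3), (132 * B ^+ 2)^-1.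
split; first by rewrite exprn_gt0.
split; first by rewrite exprn_gt0.
split; first by rewrite invr_gt0 mulr_gt0 // exprn_gt0.
move=> Delta l L2 mu eps Delta0 l0 L20 mu0 eps0 kappa.
rewrite le_min => /andP[cond1 cond2].
have [lam lE] : exists lam, l = 29 * lam by exists (l / 29); field.
have lam0 : 0 < lam by lra.
have mul : mu <= l by move: kappa; rewrite ler_pdivlMr // mul1r.
have q1 : 841 <= B ^+ 3.
  have B2 : 841 <= B ^+ 2.
    by have := ler_pM (ler0n _ 29) (ler0n _ 29) B29 B29; rewrite -expr2; lra.
  by have := ler_wpM2r (ltW B0) B2; rewrite -exprSr; lra.
have b_le1 := root7_le1 lam0 L20 eps0 (first_condition L20 eps0 q1 lE cond1).
have gap := initial_gap Delta0 lam0 L20 eps0 BE lE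
  (second_condition Delta0 l0 L20 eps0 B0 cond2).
have rate := rate_decrease lam0 L20 eps0 BE lE.
have grad_large := gradient_gt_eps lam0 L20 eps0.
have M0 := decrease_gt0 lam0 L20 eps0.
have b0 := root7_gt0 lam0 L20 eps0.
have s0 := radius_gt0 lam0 L20 eps0.
have hess : lam * (root7 lam L2 eps ^+ 2) ^+ 2 * 72 / radius lam L2 eps = L2.
  by rewrite /radius; move: (root7 _ _ _) b0 => b b0; field; rewrite !gt_eqF.
have ME : decrease lam L2 eps = lam * radius lam L2 eps ^+ 2 * root7 lam L2 eps ^+ 2 *
    root7 lam L2 eps ^+ 2 by rewrite /decrease; ring.
move: rate grad_large gap M0 s0 hess ME.
move: (decrease _ _ _) (radius _ _ _) (root7 _ _ _) b0 b_le1 => M s b b0 b1.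
move=> rate grad_large gap M0 s0 hess ME.
have b21 : b ^+ 2 <= 1 by rewrite expr_le1 // ltW.
have A0 : 0 <= lam * s ^+ 2 * b ^+ 2.
  by apply: mulr_ge0; [apply: mulr_ge0; [exact: ltW|] |]; exact: sqr_ge0.
have M_le : M <= lam * s ^+ 2 * b ^+ 2 by rewrite ME ler_piMr.
(* The wells then use at most half of [Delta], and by [gap] the pull on the first site at most a
   twelfth. *)
pose r := Delta / (3 * M); pose T := Num.truncn r.
have rM : r * (3 * M) = Delta by rewrite /r divfK // gt_eqF // mulr_gt0.
have r2 : 2 <= r by rewrite /r ler_pdivlMr ?mulr_gt0 //; lra.
have /andP[T1 T2] : T%:R <= r < T.+1%:R by apply: truncn_itv; lra.
(* Needed for [T.-1 >= T / 2]: a single site would give no lower bound. *)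
have T_ge2 : (2 <= T)%N by rewrite -ltnS -(ltr_nat Rr); lra.
have T0 : (0 < T)%N by exact: ltnW.
have [P [d [e [f [hf kP]]]]] := hard_function_exists lam0 (exprn_gt0 2 b0) b21 s0 T0 mu0 lE mul.
have [f1 [f2 [f3 [f4 _]]]] := hf.
exists d, e, f; split; first by rewrite lE.
split=> //; split; first by rewrite -hess.
split.
  move=> x; apply: le_trans (f4 x) _.
  have -> : lam * s ^+ 2 * (b ^+ 2 / 2 + 3 / 2 * (b ^+ 2) ^+ 2 * T%:R) =
    lam * s ^+ 2 * b ^+ 2 / 2 + T%:R * (3 * M) / 2 by rewrite ME; field.
  have : T%:R * (3 * M) <= Delta by rewrite -rM ler_pM2r // mulr_gt0.
  by lra.
move=> xs ys it t small.
have Pt := hard_function_lower_bound hf (ltW eps0) grad_large it small.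
have tP : P%:R * T%:R / 2 <= t%:R :> Rr.
  rewrite ler_pdivrMr // -natrM -natrM ler_nat.
  apply: (@leq_trans (P * T.-1 * 2)); last by rewrite leq_mul2r ltnW ?orbT.
  rewrite -mulnA leq_mul2l; apply/orP; right.
  by case: (T) T_ge2 => [//|[//|n]] _ /=; rewrite muln2 -addnn addSn addnS !ltnS leq_addl.
have TM : Delta <= 6 * M * T%:R.
  have : r <= 2 * T%:R.
    by have : 1 <= (T%:R : Rr) by [rewrite ler1n]; move: T2; rewrite -natr1; lra.
  by rewrite -(ler_pM2r (mulr_gt0 (ltr0n _ 3) M0)) rM; lra.
have K0 := sqrtr_ge0 (l / mu).
move: rate; set E := powR l (3/7) * powR L2 (2/7) * powR eps (- (12/7)) => rate.
have E0 : 0 <= E by rewrite !mulr_ge0 ?powR_ge0.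
have -> : (132 * B ^+ 2)^-1 * Delta * Num.sqrt (l / mu) * powR l (3 / 7) *
  powR L2 (2 / 7) * powR eps (- (12 / 7)) = Delta * Num.sqrt (l / mu) * E / (132 * B ^+ 2).
  by rewrite /E; ring.
apply: le_trans tP; rewrite ler_pdivrMr ?mulr_gt0 ?exprn_gt0 //.
apply: (@le_trans _ _ (6 * M * T%:R * (11 * P%:R) * E)).
  apply: ler_wpM2r => //; apply: ler_pM => //; exact: ltW.
have -> : 6 * M * T%:R * (11 * P%:R) * E = (66 * T%:R * P%:R) * (M * E) by ring.
have -> : P%:R * T%:R / 2 * (132 * B ^+ 2) = (66 * T%:R * P%:R) * B ^+ 2 by field.
by apply: ler_wpM2l => //; rewrite !mulr_ge0.
Qed.
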